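(* For positive integers $a,b$ define \[ G^T_{a,b}(x) = \frac{x^{a+2b} + x^{a} - x^{2a+b} - x^{b} - x^{a+b}}{x^{\min\{a,b\}}} \in \mathbb{Z}[x], \] which equals $x^{a+b}P^T(x^a,x^b)/x^{\min\{a,b\}}$ for $P^T(x,y) = y + y^{-1} - (x + x^{-1} + 1)$. Let $C^T_{a,b}(x)$ be the product of the distinct cyclotomic polynomials arising from the following three rules: (I) if $(a,b) = (a_1 d_1, b_1 d_1)$ with $d_1 \in \mathbb{Z}^{+}$ and $(a_1,b_1)$ congruent modulo $6$ to one of $(1,0)$, $(3,2)$, $(3,-2)$, $(5,0)$, then $\Phi_{6d_1}(x)$ arises; (II) if $(a,b) = (a_2 d_2, b_2 d_2)$ with $d_2 \in \mathbb{Z}^{+}$ and $(a_2,b_2)$ congruent modulo $10$ to one of $(2,\pm 1)$, $(4,\pm 3)$, $(6,\pm 3)$, $(8,\pm 1)$, then $\Phi_{10 d_2}(x)$ arises; (III) if $(a,b) = (a_3 d_3, b_3 d_3)$ with $d_3 \in \mathbb{Z}^{+}$ and $(a_3,b_3)$ congruent modulo $12$ to one of $(3,\pm 2)$, $(4,\pm 3)$, $(8,\pm 3)$, $(9,\pm 2)$, then $\Phi_{12 d_3}(x)$ arises. Then for all positive integers $a,b$: (a) the cyclotomic part of $G^T_{a,b}(x)$ is $C^T_{a,b}(x)$ (that is, $C^T_{a,b}(x)$ divides $G^T_{a,b}(x)$, each of its cyclotomic factors divides $G^T_{a,b}(x)$ with multiplicity exactly one, and $G^T_{a,b}(x)/C^T_{a,b}(x)$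 has no cyclotomic factor); (b) if $a \ne b$, then $G^T_{a,b}(x)$ is a product of irreducible reciprocal polynomials; (c) assuming Lehmer's Conjecture, there is an absolute constant $C$ such that if $\max\{a/b, b/a\} > C$, then $G^T_{a,b}(x)/C^T_{a,b}(x)$ is irreducible.
   Context: $\Phi_k(x)$ denotes the $k$-th cyclotomic polynomial. A non-zero polynomial $w(x) \in \mathbb{R}[x]$ is reciprocal if $w(x) = \pm x^{\deg w} w(1/x)$. The cyclotomic part of a polynomial in $\mathbb{Z}[x]$ is the product of its cyclotomic irreducible factors counted with multiplicity. The Mahler measure of $p(x) \in \mathbb{C}[x]$ is $M(p) = \exp\left(\int_0^1 \log|p(e^{2\pi i t})|\,dt\right)$. Lehmer's Conjecture asserts that every polynomial $p(x) \in \mathbb{Z}[x]$ that is irreducible over $\mathbb{Z}$ and not cyclotomic and not $\pm x$ satisfies $M(p) \ge M(x^{10}+x^9-x^7-x^6-x^5-x^4-x^3+x+1) = 1.176280818\ldots$ (equivalently: any $p \in \mathbb{Z}[x]$ with $M(p) > 1$ has $M(p) \ge 1.176280818\ldots$). *)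

(* Defs.v *)
From HB Require Import structures.
From mathcomp Require Import all_boot all_order all_algebra.
From mathcomp Require Import cyclotomic.
From mathcomp Require Import classical_sets reals ereal sequences exp trigo
  measure lebesgue_measure lebesgue_integral.

Set Implicit Arguments.
Unset Strict Implicit.
Unset Printing Implicit Defensive.

Import Order.TTheory GRing.Theory Num.Theory.
Local Open Scope ring_scope.

Definition GT (a b : nat) : {poly int} :=
  ('X^(a + 2 * b) + 'X^a - 'X^(2 * a + b) - 'X^b - 'X^(a + b))
    %/ 'X^(minn a b).

(* The residue-pair lists of rules (I), (II), (III); negative residues
   are written as their least nonnegative representatives. *)
Definition ruleI_pairs : seq (nat * nat) := [:: (1,0); (3,2); (3,4); (5,0)]%N.
Definition ruleII_pairs : seq (nat * nat) :=
  [:: (2,1); (2,9); (4,3); (4,7); (6,3); (6,7); (8,1); (8,9)]%N.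
Definition ruleIII_pairs : seq (nat * nat) :=
  [:: (3,2); (3,10); (4,3); (4,9); (8,3); (8,9); (9,2); (9,10)]%N.

(* Rule with modulus m: (a,b) = (a' d, b' d), d > 0, (a',b') = some pair mod m;
   the cyclotomic polynomial Phi_(m d) then arises. *)
Definition rule_arises (m : nat) (pairs : seq (nat * nat)) (a b n : nat) : bool :=
  [&& (m %| n)%N, (0 < n %/ m)%N, (n %/ m %| a)%N, (n %/ m %| b)%N &
      (((a %/ (n %/ m)) %% m, (b %/ (n %/ m)) %% m)%N \in pairs)].

Definition arises (a b n : nat) : bool :=
  [|| rule_arises 6 ruleI_pairs a b n, rule_arises 10 ruleII_pairs a b n
    | rule_arises 12 ruleIII_pairs a b n].

(* C^T_{a,b}: product of the distinct Phi_n arising.  Any arising n is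
   m*d with d | a, so n <= 12 a < 12 (a + b) + 1: the range is exhaustive. *)
Definition CT (a b : nat) : {poly int} :=
  \prod_(n < (12 * (a + b)).+1 | arises a b n) 'Phi_n.

Definition irreducibleZ (p : {poly int}) : Prop :=
  [/\ p != 0, p \isn't a GRing.unit &
      forall q r : {poly int}, p = q * r -> q \is a GRing.unit \/ r \is a GRing.unit].

(* w reciprocal: w nonzero and w(x) = +- x^(deg w) w(1/x), i.e. coefficientwise *)
Definition reciprocal (w : {poly int}) : Prop :=
  w != 0 /\ exists2 s : int, (s = 1 \/ s = -1) &
    forall i, (i <= (size w).-1)%N -> w`_i = s * w`_((size w).-1 - i).

Definition is_cyclotomic (p : {poly int}) : Prop :=
  exists2 k, (0 < k)%N & (p = 'Phi_k \/ p = - 'Phi_k).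

(* Mahler measure M(p) = exp(int_0^1 log|p(e^{2 pi i t})| dt), with
   |p(e^{i th})|^2 = (sum_k p_k cos(k th))^2 + (sum_k p_k sin(k th))^2 and
   log|z| = log(|z|^2)/2. *)
Definition circ_re (R : realType) (p : {poly int}) (t : R) : R :=
  \sum_(k < size p) (p`_k)%:~R * cos (k%:R * (2 * pi * t)).
Definition circ_im (R : realType) (p : {poly int}) (t : R) : R :=
  \sum_(k < size p) (p`_k)%:~R * sin (k%:R * (2 * pi * t)).
Definition mahler (R : realType) (p : {poly int}) : R :=
  expR (Rintegral (@lebesgue_measure R) `[0%R, 1%R]%classic
          (fun t => ln (circ_re p t ^+ 2 + circ_im p t ^+ 2) / 2)).

Definition lehmer_poly : {poly int} :=
  Poly [:: 1; 1; 0; -1; -1; -1; -1; -1; 0; 1; 1].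

Definition LehmerConjecture (R : realType) : Prop :=
  forall p : {poly int}, irreducibleZ p -> ~ is_cyclotomic p ->
    p <> 'X -> p <> - 'X -> mahler R lehmer_poly <= mahler R p.

(* Main.v *)
(* Put F = GT up to sign and a power of x, so that F = v + 1/v - u - 1/u - 1 with u = x^a and
   v = x^b.  (a) If F vanishes at a primitive k-th root z, it vanishes at a conjugate of z of the
   form z^2, -z^2 or -z, which gives a second equation between u + 1/u and v + 1/v; the few
   solutions are the three rules, and none of them is a double root.
   (b) If GT = q r, then W = q r* satisfies W W* = GT GT*.  Comparing constant terms, W has five
   coefficients +-1, and comparing the other terms W = +-GT, whence q = +-q*.
   (c) Jensen's formula makes Mahler measures multiplicative and bounds the measure of Lehmer's
   polynomial below by its real root.  With m = max(a, b), the product of GT over the translates of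
   its argument by m-th roots of unity freezes the fast variable x^m and has the roots alpha^m,
   where alpha runs over the roots of GT; bounding it pointwise shows that the measure of GT is at
   most (131/50)^(1/3) up to a factor tending to 1.  As this is less than the square of the measure
   of Lehmer's polynomial, GT / CT cannot have two noncyclotomic factors. *)

Require Import Defs.
From HB Require Import structures.
From mathcomp Require Import all_boot all_order all_algebra.
From mathcomp Require Import cyclotomic.
From mathcomp Require Import classical_sets reals.
From mathcomp Require Import all_field cyclic separable.
From mathcomp Require Import all_classical all_reals all_analysis.
From mathcomp Require Import measurable_realfun.
From mathcomp Require Import complex.
From mathcomp Require Import zify ring lra.
Import Order.TTheory GRing.Theory Num.Theory.
Local Open Scope ring_scope.

(** Part (c) rests on a one-sided bound for Mahler measures rather than on a limit theorem, and
    rational constants have just enough room. With the fast variable frozen at e^(2 i pi t), the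
    roots s of s + 1/s = 2 cos(2 pi t) + e, e = 1 or -1, leave the unit circle only for t in a set
    of measure 1/3, and there the larger one is at most (3 + sqrt 5)/2 in modulus. This is the
    origin of the exponent 1/3, and the argument closes because (3 + sqrt 5)/2 < 131/50 < (47/40)^6
    while 47/40 lies below Lehmer's root. The slow variable runs through a full set of (m / g)-th
    roots of unity g times, g = gcd(a, b), and each turn costs a factor at most 16. The total error
    g ln 16 has to be small against m, which is what a large ratio of a and b ensures. The
    convention [ln 0 = 0] shapes the analysis: additivity of logarithmic integrals and the passage
    to the unit circle hold only off the zeros, so these are shown to be negligible. *)

Local Notation pZtoC := (map_poly (intr : int -> algC)).

(** * Cyclotomic factors *)

(* [ring] would otherwise try to normalise the symbolic exponents. *)
Ltac ring_Xn :=
  repeat match goal with |- context [@GRing.exp _ 'X ?n] =>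
    let y := fresh in set y := 'X^n : {poly int}; clearbody y end; ring.

Definition GT_num (a b : nat) : {poly int} :=
  'X^(a + 2 * b) + 'X^a - 'X^(2 * a + b) - 'X^b - 'X^(a + b).

Lemma GT_lt a b : (b < a)%N ->
  GT a b = - 'X^(2 * a) + 'X^(a + b) - 'X^a + 'X^(a - b) - 1.
Proof.
move=> lt_ba; rewrite /GT (minn_idPr (ltnW lt_ba)).
have -> : 'X^(a + 2 * b) + 'X^a - 'X^(2 * a + b) - 'X^b - 'X^(a + b) =
   (- 'X^(2 * a) + 'X^(a + b) - 'X^a + 'X^(a - b) - 1) * 'X^b :> {poly int}.
  rewrite !(mulrDl, mulNr) -!exprD mul1r.
  have -> : (a - b + b = a)%N by lia.
  have -> : (a + b + b = a + 2 * b)%N by lia.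
  by ring_Xn.
by rewrite Pdiv.IdomainMonic.mulpK ?monicXn.
Qed.

Lemma GT_gt a b : (a < b)%N ->
  GT a b = 'X^(2 * b) - 'X^(b + a) - 'X^b - 'X^(b - a) + 1.
Proof.
move=> lt_ab; rewrite /GT (minn_idPl (ltnW lt_ab)).
have -> : 'X^(a + 2 * b) + 'X^a - 'X^(2 * a + b) - 'X^b - 'X^(a + b) =
   ('X^(2 * b) - 'X^(b + a) - 'X^b - 'X^(b - a) + 1) * 'X^a :> {poly int}.
  rewrite !(mulrDl, mulNr) -!exprD mul1r.
  have -> : (b - a + a = b)%N by lia.
  have -> : (2 * b + a = a + 2 * b)%N by lia.
  have -> : (b + a + a = 2 * a + b)%N by lia.
  by rewrite (addnC b a); ring_Xn.
by rewrite Pdiv.IdomainMonic.mulpK ?monicXn.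
Qed.

Lemma GT_eq a : GT a a = - 'X^a.
Proof.
rewrite /GT minnn.
have -> : 'X^(a + 2 * a) + 'X^a - 'X^(2 * a + a) - 'X^a - 'X^(a + a) =
   (- 'X^a) * 'X^a :> {poly int}.
  rewrite mulNr -exprD.
  have -> : (2 * a + a = a + 2 * a)%N by lia.
  by ring_Xn.
by rewrite Pdiv.IdomainMonic.mulpK ?monicXn.
Qed.

Lemma GT_mulXn a b : GT a b * 'X^(minn a b) = GT_num a b.
Proof.
rewrite /GT_num; case: (ltngtP a b) => [lt|lt|<-].
- rewrite GT_gt // !(mulrDl, mulNr) -!exprD mul1r.
  have -> : (b - a + a = b)%N by lia.
  have -> : (2 * b + a = a + 2 * b)%N by lia.
  have -> : (b + a + a = 2 * a + b)%N by lia.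
  by rewrite (addnC b a); ring_Xn.
- rewrite GT_lt // !(mulrDl, mulNr) -!exprD mul1r.
  have -> : (a - b + b = a)%N by lia.
  have -> : (a + b + b = a + 2 * b)%N by lia.
  by ring_Xn.
- rewrite GT_eq mulNr -exprD.
  have -> : (2 * a + a = a + 2 * a)%N by lia.
  by ring_Xn.
Qed.

Lemma GT_horner1 a b : (GT a b).[1] = -1.
Proof.
case: (ltngtP a b) => [lt|lt|<-]; [rewrite GT_gt //|rewrite GT_lt //|rewrite GT_eq];
  by rewrite !(hornerD, hornerN, hornerXn, hornerC, expr1n).
Qed.

Lemma GT_neq0 a b : GT a b != 0.
Proof. by apply/eqP=> G0; have := GT_horner1 a b; rewrite G0 horner0. Qed.

Lemma root_GT (z : algC) a b : z != 0 ->
  root (pZtoC (GT a b)) z =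
  (z ^+ b + z ^- b - (z ^+ a + z ^- a) == 1).
Proof.
move=> z0.
have -> : root (pZtoC (GT a b)) z = root (pZtoC (GT_num a b)) z.
  rewrite -GT_mulXn rmorphM /= map_polyXn rootM /root hornerXn expf_eq0 (negPf z0).
  by rewrite andbF orbF.
have za : z ^+ a != 0 by rewrite expf_neq0.
have zb : z ^+ b != 0 by rewrite expf_neq0.
rewrite /root /GT_num !(rmorphD, rmorphN) /= !map_polyXn.
rewrite !(hornerD, hornerN, hornerXn) !(mulnC 2) !exprD !exprM.
rewrite -[RHS]subr_eq0.
have -> : z ^+ b + z ^- b - (z ^+ a + z ^- a) - 1 =
  (z ^+ a * z ^+ b) ^-1 * (z ^+ a * z ^+ b ^+ 2 + z ^+ a - z ^+ a ^+ 2 * z ^+ b - z ^+ b - z ^+ a * z ^+ b).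
  by field; rewrite za zb.
by rewrite mulf_eq0 invr_eq0 mulf_eq0 (negPf za) (negPf zb).
Qed.

(** Divisibility of integer polynomials agrees with divisibility over the rationals, where ['Phi_k]
    is the minimal polynomial of [z]. *)
Lemma Phi_dvdpE (k : nat) (z : algC) (p : {poly int}) :
  k.-primitive_root z -> ('Phi_k %| p) = root (pZtoC p) z.
Proof.
move=> prim_z; rewrite -dvdp_rat_int.
have ratrint (q : {poly int}) : map_poly ratr (map_poly intr q : {poly rat}) = pZtoC q.
  by rewrite -map_poly_comp; apply: eq_map_poly => x /=; rewrite ratr_int.
have [q [Dq _ dv_q]] := minCpolyP z.
rewrite -ratrint dv_q; congr (_ %| _).
apply: (map_inj_poly (fmorph_inj (@ratr algC)) (rmorph0 _)).
by rewrite ratrint (Cintr_Cyclotomic prim_z) -(minCpoly_cyclotomic prim_z) -Dq.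
Qed.

(** * Traces x + 1/x at roots of unity *)

Definition tr (x : algC) : algC := x + x^-1.

Lemma tr_sqr x : x != 0 -> tr (x ^+ 2) = tr x ^+ 2 - 2.
Proof. by move=> x0; rewrite /tr; field. Qed.

Lemma trN x : tr (- x) = - tr x.
Proof. by rewrite /tr invrN opprD. Qed.

Lemma tr_signM n x : tr ((-1) ^+ n * x) = (-1) ^+ n * tr x.
Proof. by rewrite -signr_odd; case: odd; rewrite ?expr1 ?mulN1r ?trN // !mul1r. Qed.

Lemma prim_neq0 k (z : algC) : k.-primitive_root z -> z != 0.
Proof.
move=> pz; apply/eqP=> z0; move: (prim_expr_order pz) (prim_order_gt0 pz).
by rewrite z0; case: k {pz} => // k; rewrite expr0n /= => /eqP; rewrite eq_sym oner_eq0.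
Qed.

(** Both relations say that ['Phi_k] divides [GT a b]; this plays the part of a Galois
    automorphism. *)
Lemma prim_conj k (z z' : algC) a b :
  k.-primitive_root z -> k.-primitive_root z' ->
  tr (z ^+ b) - tr (z ^+ a) = 1 -> tr (z' ^+ b) - tr (z' ^+ a) = 1.
Proof.
move=> pz pz' /eqP E; apply/eqP.
rewrite -[_ == _](root_GT _ _ _ (prim_neq0 _ _ pz')) -(Phi_dvdpE _ _ _ pz').
by rewrite (Phi_dvdpE _ _ _ pz) (root_GT _ _ _ (prim_neq0 _ _ pz)).
Qed.

Lemma prim_half k (z : algC) : k.-primitive_root z -> ~~ odd k -> z ^+ k./2 = -1.
Proof.
move=> pz ek; have k0 := prim_order_gt0 pz.
have : (z ^+ k./2) ^+ 2 == 1.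
  by rewrite -exprM (_ : (k./2 * 2 = k)%N) ?(prim_expr_order pz) //; lia.
rewrite sqrf_eq1 => /orP[|/eqP //].
by rewrite -(prim_order_dvd pz) => /dvdn_leq; lia.
Qed.

Lemma eq0_of_eq (x y t : algC) : x = y -> t = x - y \/ t = y - x -> t = 0.
Proof. by move=> -> [] ->; rewrite subrr. Qed.

(** In terms of the orders of the roots of unity u and v with traces [U] and [V], the cases are (6,
    1), (2, 3), (3, 4), (4, 6) and (5, 10). The first two make up rule (I), the next two rule (III),
    the last one rule (II). *)
Definition trace_values (U V : algC) : Prop :=
  [\/ U = 1 /\ V = 2, U = -2 /\ V = -1, U = -1 /\ V = 0 | U = 0 /\ V = 1]
  \/ U ^+ 2 + U = 1 /\ V = U + 1.

(* A primitive k-th root z is conjugate to z^2, - z^2 or - z, according to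
   whether k is odd, twice odd, or a multiple of 4; the relation at the conjugate
   is a second equation between the two traces. *)
Lemma trace_classification k (z : algC) a b : k.-primitive_root z ->
  tr (z ^+ b) - tr (z ^+ a) = 1 -> trace_values (tr (z ^+ a)) (tr (z ^+ b)).
Proof.
elim/ltn_ind: k z a b => k IH z a b pz E.
have k0 := prim_order_gt0 pz.
have z0 := prim_neq0 _ _ pz.
have zn0 n : z ^+ n != 0 by rewrite expf_neq0.
set U := tr (z ^+ a) in E *; set V := tr (z ^+ b) in E *.
have DV : V = U + 1 by rewrite -E; ring.
have solve1 : V ^+ 2 - U ^+ 2 = 1 -> trace_values U V.
  rewrite DV => E2; have U0 : U = 0.
    have: 2 * U = 0 by apply: (eq0_of_eq _ _ _ E2); first [left; rewrite ?DV; ring | right; rewrite ?DV; ring].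
    by move/eqP; rewrite mulf_eq0 pnatr_eq0 /= => /eqP.
  by rewrite U0 add0r; left; constructor 4.
have solve2 : V ^+ 2 - U ^+ 2 = -1 -> trace_values U V.
  rewrite DV => E2; have U0 : U = -1.
    have: 2 * (U + 1) = 0 by apply: (eq0_of_eq _ _ _ E2); first [left; rewrite ?DV; ring | right; rewrite ?DV; ring].
    by move/eqP; rewrite mulf_eq0 pnatr_eq0 /= addr_eq0 => /eqP.
  by rewrite U0 addNr; left; constructor 3.
have [ok|ek] := boolP (odd k).
  have pz2 : k.-primitive_root (z ^+ 2) by rewrite prim_root_exp_coprime // coprime2n.
  apply: solve1; rewrite -(prim_conj _ _ _ _ _ pz pz2 E) !(exprAC _ 2) !tr_sqr // -/U -/V.
  by ring.
have zh := prim_half _ _ pz ek.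
have [k4|k4] := boolP (4 %| k)%N.
  have pzN : k.-primitive_root (- z).
    have -> : - z = z ^+ (k./2).+1 by rewrite exprSr zh mulN1r.
    rewrite prim_root_exp_coprime //; case/dvdnP: k4 => j ->.
    have -> : (j * 4)./2 = (j * 2)%N by lia.
    have -> : (j * 4 = j * 2 * 2)%N by lia.
    by rewrite coprimeMr coprimeSn coprimen2 /= oddM andbF.
  move: (prim_conj _ _ _ _ _ pz pzN E).
  rewrite !(exprNn z) !tr_signM -/U -/V -[(-1) ^+ a]signr_odd -[(-1) ^+ b]signr_odd.
  have [oa|ea] := boolP (odd a); have [ob|eb] := boolP (odd b);
     rewrite ?expr0 ?expr1 ?mul1r ?mulN1r => E2.
  - have: 2 = 0 :> algC by apply: (eq0_of_eq _ _ _ E2); first [left; rewrite ?DV; ring | right; rewrite ?DV; ring].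
    by move/eqP; rewrite pnatr_eq0.
  - have U0 : U = 0.
      have: 2 * U = 0 by apply: (eq0_of_eq _ _ _ E2); first [left; rewrite ?DV; ring | right; rewrite ?DV; ring].
      by move/eqP; rewrite mulf_eq0 pnatr_eq0 /= => /eqP.
    by rewrite DV U0 add0r; left; constructor 4.
  - have U0 : U = -1.
      have: 2 * (U + 1) = 0 by apply: (eq0_of_eq _ _ _ E2); first [left; rewrite ?DV; ring | right; rewrite ?DV; ring].
      by move/eqP; rewrite mulf_eq0 pnatr_eq0 /= addr_eq0 => /eqP.
    by rewrite DV U0 addNr; left; constructor 3.
  (* For even [a] and [b] the conjugate - z gives the same equation again; but then only z^2
     matters, of order k / 2, and induction applies. *)
  - have pz2 : (k./2).-primitive_root (z ^+ 2).
      have := exp_prim_root pz 2; rewrite (_ : gcdn 2 k = 2)%N ?divn2 //.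
      by apply/gcdn_idPl; lia.
    have Ea : z ^+ a = z ^+ 2 ^+ a./2 by rewrite -exprM; congr (_ ^+ _); lia.
    have Eb : z ^+ b = z ^+ 2 ^+ b./2 by rewrite -exprM; congr (_ ^+ _); lia.
    rewrite /U /V Ea Eb; apply: (IH k./2); [by lia | by [] |].
    by rewrite -Ea -Eb.
(* Here k / 2 is odd, so the exponent k / 2 + 2 is odd and coprime to k / 2. The parities of [a] and
   [b] decide the signs of the two traces at - z^2, and each choice of signs leads to its own
   quadratic equation in [U]. *)
have pzN : k.-primitive_root (- z ^+ 2).
  have -> : - z ^+ 2 = z ^+ (k./2 + 2) by rewrite exprD zh mulN1r.
  rewrite prim_root_exp_coprime //.
  have -> : k = (2 * k./2)%N by lia.
  rewrite coprimeMr coprimen2 (_ : (2 * k./2)./2 = k./2)%N; last by lia.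
  rewrite addnC coprime_sym /coprime gcdnDr -/(coprime _ _) coprimen2.
  by apply/andP; split; lia.
move: (prim_conj _ _ _ _ _ pz pzN E).
rewrite !(exprNn (z ^+ 2)) !tr_signM !(exprAC _ 2) !tr_sqr // -/U -/V.
rewrite -[(-1) ^+ a]signr_odd -[(-1) ^+ b]signr_odd.
have [oa|ea] := boolP (odd a); have [ob|eb] := boolP (odd b);
     rewrite ?expr0 ?expr1 ?mul1r ?mulN1r => E2.
- by apply: solve2; rewrite -E2; ring.
- have : (U - 1) * (U + 2) == 0.
    have: 2 * ((U - 1) * (U + 2)) = 0 by apply: (eq0_of_eq _ _ _ E2); first [left; rewrite ?DV; ring | right; rewrite ?DV; ring].
    by move/eqP; rewrite mulf_eq0 pnatr_eq0.
  rewrite mulf_eq0 subr_eq0 addr_eq0 => /orP[]/eqP U0; rewrite DV U0.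
    by left; constructor 1; split=> //; ring.
  by left; constructor 2; split=> //; ring.
- right; split=> //.
  have: 2 * (U ^+ 2 + U - 1) = 0 by apply: (eq0_of_eq _ _ _ E2); first [left; rewrite ?DV; ring | right; rewrite ?DV; ring].
  by move/eqP; rewrite mulf_eq0 pnatr_eq0 /= subr_eq0 => /eqP.
- by apply: solve1; rewrite -E2; ring.
Qed.

Lemma dvdn_prime_cofactor p k n :
  prime p -> (k %| p * n)%N -> ~~ (k %| n)%N -> (p %| k)%N.
Proof.
move=> pp dv; apply: contraR; rewrite -prime_coprime // coprime_sym => co.
by rewrite -(Gauss_dvdr _ co).
Qed.

Lemma rule_arises_mul m pairs a b d : (0 < m)%N -> (0 < d)%N ->
  rule_arises m pairs (a * d) (b * d) (m * d) = ((a %% m, b %% m)%N \in pairs).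
Proof.
by move=> m0 d0; rewrite /rule_arises dvdn_mulr // mulKn // d0 !dvdn_mull // !mulnK.
Qed.

Section TraceInversion.

Variable x : algC.
Hypothesis x0 : x != 0.

Lemma tr_quadratic t : tr x = t -> x ^+ 2 - t * x + 1 = 0.
Proof. by move=> <-; rewrite /tr; field. Qed.

Lemma tr_eq2 : tr x = 2 -> x = 1.
Proof.
move/tr_quadratic => E; apply/eqP; rewrite -subr_eq0 -sqrf_eq0 -E.
by apply/eqP; ring.
Qed.

Lemma tr_eqN2 : tr x = -2 -> x = -1.
Proof.
move/tr_quadratic => E; apply/eqP; rewrite -addr_eq0 -sqrf_eq0 -E.
by apply/eqP; ring.
Qed.

Lemma tr_eq0 : tr x = 0 -> x ^+ 2 = -1.
Proof. by move/tr_quadratic => /eqP; rewrite mul0r subr0 addr_eq0 => /eqP. Qed.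

Lemma tr_eq1 : tr x = 1 -> x ^+ 3 = -1 /\ x ^+ 2 != 1.
Proof.
move/tr_quadratic => E; have x3 : x ^+ 3 = -1.
  by apply/eqP; rewrite -addr_eq0 -(mulr0 (x + 1)) -E; apply/eqP; ring.
split=> //; apply/eqP=> x2; move: x3 E; rewrite exprS x2 mulr1 => ->.
by move/eqP; rewrite mul1r opprK (_ : 1 + 1 + 1 = 3%:R) ?pnatr_eq0 //; ring.
Qed.

Lemma tr_eqN1 : tr x = -1 -> x ^+ 3 = 1 /\ x != 1.
Proof.
move/tr_quadratic => E; have x3 : x ^+ 3 = 1.
  by apply/eqP; rewrite -subr_eq0 -(mulr0 (x - 1)) -E; apply/eqP; ring.
split=> //; apply/eqP=> x1; move: E; rewrite x1 expr1n.
by move/eqP; rewrite mulN1r opprK (_ : 1 + 1 + 1 = 3%:R) ?pnatr_eq0 //; ring.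
Qed.

End TraceInversion.

Lemma tr_inj x y : x != 0 -> y != 0 -> tr x = tr y -> x = y \/ x * y = 1.
Proof.
move=> x0 y0 E; have : (x - y) * (x * y - 1) == 0.
  have -> : (x - y) * (x * y - 1) = x * y * (tr x - tr y) by rewrite /tr; field; rewrite x0 y0.
  by rewrite E subrr mulr0.
by rewrite mulf_eq0 !subr_eq0 => /orP[]/eqP; [left | right].
Qed.

(** With t = x + 1/x, the product x^2 (t^2 + t - 1) is the fifth cyclotomic polynomial. *)
Lemma tr_golden x : x != 0 -> tr x ^+ 2 + tr x = 1 -> x ^+ 5 = 1 /\ x != 1.
Proof.
move=> x0 E; have E4 : x ^+ 4 + x ^+ 3 + x ^+ 2 + x + 1 = 0.
  have -> : x ^+ 4 + x ^+ 3 + x ^+ 2 + x + 1 = x ^+ 2 * (tr x ^+ 2 + tr x - 1).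
    by rewrite /tr; field.
  by rewrite E subrr mulr0.
split.
  by apply/eqP; rewrite -subr_eq0 -(mulr0 (x - 1)) -E4; apply/eqP; ring.
apply/eqP=> x1; move: E4; rewrite x1 !expr1n => /eqP.
by rewrite (_ : 1 + 1 + 1 + 1 + 1 = 5%:R) ?pnatr_eq0 //; ring.
Qed.

(** The orders of z^a and z^b say which small multiples of [a] and [b] are divisible by [k]. A prime
    that turns a nonmultiple of [k] into a multiple divides [k]; hence k = m d for the modulus m of
    the rule, and the same divisibilities then give the residues of a / d and b / d. *)
Lemma arises_of_trace k (z : algC) a b : k.-primitive_root z ->
  trace_values (tr (z ^+ a)) (tr (z ^+ b)) -> arises a b k.
Proof.
move=> pz; have k0 := prim_order_gt0 pz.
have z0 n : z ^+ n != 0 by rewrite expf_neq0 // (prim_neq0 _ _ pz).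
have dvE n : (k %| n)%N = (z ^+ n == 1) := prim_order_dvd pz n.
have N1 : -1 != 1 :> algC by rewrite lt_eqF // (lt_trans (ltrN10 _)) ?ltr01.
rewrite /arises; case=> [[]|] [Ua Vb].
- have {}Vb : (k %| b)%N by rewrite dvE (tr_eq2 _ (z0 b) Vb).
  have [u3 u2] := tr_eq1 _ (z0 a) Ua.
  have d3 : ~~ (k %| 3 * a)%N by rewrite dvE mulnC exprM u3.
  have d2 : ~~ (k %| 2 * a)%N by rewrite dvE mulnC exprM.
  have d6 : (k %| 6 * a)%N by rewrite dvE (_ : 6 * a = a * 3 * 2)%N ?exprM ?u3 ?sqrrN ?expr1n //; lia.
  have k2 : (2 %| k)%N by apply: (dvdn_prime_cofactor _ _ (3 * a)) => //; rewrite mulnA.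
  have k3 : (3 %| k)%N by apply: (dvdn_prime_cofactor _ _ (2 * a)) => //; rewrite mulnA.
  have /dvdnP[d Dk] : (6 %| k)%N by rewrite (@Gauss_dvd 2 3) // k2.
  move: Vb d2 d3 d6 k0; rewrite Dk (mulnC d) => /dvdnP[b' ->] d2 d3.
  rewrite dvdn_pmul2l // => /dvdnP[a' Da]; rewrite muln_gt0 => /= d0.
  move: d2 d3; rewrite Da !mulnA !dvdn_pmul2r // => d2 d3.
  have ? : (~~ (3 %| a'))%N by lia.
  have ? : (~~ (2 %| a'))%N by lia.
  apply/orP; left; rewrite rule_arises_mul //.
  have ha : (a' %% 6 = 1 \/ a' %% 6 = 5)%N by lia.
  have hb : (b' * 6 %% 6 = 0)%N by lia.
  by case: ha => ->; rewrite hb.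
- have u1 := tr_eqN2 _ (z0 a) Ua.
  have [v3 v1] := tr_eqN1 _ (z0 b) Vb.
  have a1 : ~~ (k %| a)%N by rewrite dvE u1.
  have a2 : (k %| 2 * a)%N by rewrite dvE mulnC exprM u1 sqrrN expr1n.
  have b1 : ~~ (k %| b)%N by rewrite dvE.
  have b3 : (k %| 3 * b)%N by rewrite dvE mulnC exprM v3.
  have k2 : (2 %| k)%N by apply: (dvdn_prime_cofactor _ _ a).
  have k3 : (3 %| k)%N by apply: (dvdn_prime_cofactor _ _ b).
  have /dvdnP[d Dk] : (6 %| k)%N by rewrite (@Gauss_dvd 2 3) // k2.
  have d0 : (0 < d)%N by move: k0; rewrite Dk muln_gt0 andbT.
  have /dvdnP[a' Da] : (3 * d %| a)%N by rewrite -(@dvdn_pmul2l 2) // mulnA mulnC -Dk.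
  have /dvdnP[b' Db] : (2 * d %| b)%N by rewrite -(@dvdn_pmul2l 3) // mulnA mulnC -Dk.
  move: a1 b1; rewrite Da Db Dk (mulnC d) !mulnA !dvdn_pmul2r // => a1 b1.
  have ? : (~~ (2 %| a'))%N by lia.
  have ? : (~~ (3 %| b'))%N by lia.
  apply/orP; left; rewrite rule_arises_mul //.
  have ha : (a' * 3 %% 6 = 3)%N by lia.
  have hb : (b' * 2 %% 6 = 2 \/ b' * 2 %% 6 = 4)%N by lia.
  by rewrite ha; case: hb => ->.
- have [u3 u1] := tr_eqN1 _ (z0 a) Ua.
  have v2 := tr_eq0 _ (z0 b) Vb.
  have a1 : ~~ (k %| a)%N by rewrite dvE.
  have a3 : (k %| 3 * a)%N by rewrite dvE mulnC exprM u3.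
  have b2 : ~~ (k %| 2 * b)%N by rewrite dvE mulnC exprM v2.
  have b4 : (k %| 2 * (2 * b))%N.
    by rewrite dvE (_ : 2 * (2 * b) = b * 2 * 2)%N ?exprM ?v2 ?sqrrN ?expr1n //; lia.
  have /dvdnP[k1 Dk1] : (2 %| k)%N by apply: (dvdn_prime_cofactor _ _ (2 * b)).
  have k2 : (2 %| k1)%N.
    apply: (dvdn_prime_cofactor _ _ b) => //.
      by rewrite -(@dvdn_pmul2l 2) // (mulnC _ k1) -Dk1.
    by apply: contra b2 => dv; rewrite Dk1 mulnC dvdn_pmul2l.
  have k4 : (4 %| k)%N by rewrite Dk1 (@dvdn_mul 2 2).
  have k3 : (3 %| k)%N by apply: (dvdn_prime_cofactor _ _ a).
  have /dvdnP[d Dk] : (12 %| k)%N by rewrite (@Gauss_dvd 3 4) // k3.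
  have d0 : (0 < d)%N by move: k0; rewrite Dk muln_gt0 andbT.
  have /dvdnP[a' Da] : (4 * d %| a)%N by rewrite -(@dvdn_pmul2l 3) // mulnA mulnC -Dk.
  have /dvdnP[b' Db] : (3 * d %| b)%N by rewrite -(@dvdn_pmul2l 4) // mulnA mulnC -Dk -(mulnA 2 2 b).
  move: a1 b2; rewrite Da Db Dk (mulnC d) !mulnA !dvdn_pmul2r // => a1 b2.
  have ? : (~~ (3 %| a'))%N by lia.
  have ? : (~~ (2 %| b'))%N by lia.
  rewrite orbA; apply/orP; right; rewrite rule_arises_mul //.
  have ha : (a' * 4 %% 12 = 4 \/ a' * 4 %% 12 = 8)%N by lia.
  have hb : (b' * 3 %% 12 = 3 \/ b' * 3 %% 12 = 9)%N by lia.
  by case: ha => ->; case: hb => ->.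
- have [v3 v2] := tr_eq1 _ (z0 b) Vb.
  have u2 := tr_eq0 _ (z0 a) Ua.
  have a2 : ~~ (k %| 2 * a)%N by rewrite dvE mulnC exprM u2.
  have a4 : (k %| 2 * (2 * a))%N.
    by rewrite dvE (_ : 2 * (2 * a) = a * 2 * 2)%N ?exprM ?u2 ?sqrrN ?expr1n //; lia.
  have b2 : ~~ (k %| 2 * b)%N by rewrite dvE mulnC exprM.
  have b3 : ~~ (k %| 3 * b)%N by rewrite dvE mulnC exprM v3.
  have b6 : (k %| 6 * b)%N.
    by rewrite dvE (_ : 6 * b = b * 3 * 2)%N ?exprM ?v3 ?sqrrN ?expr1n //; lia.
  have /dvdnP[k1 Dk1] : (2 %| k)%N by apply: (dvdn_prime_cofactor _ _ (2 * a)).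
  have k2 : (2 %| k1)%N.
    apply: (dvdn_prime_cofactor _ _ a) => //.
      by rewrite -(@dvdn_pmul2l 2) // (mulnC _ k1) -Dk1.
    by apply: contra a2 => dv; rewrite Dk1 mulnC dvdn_pmul2l.
  have k4 : (4 %| k)%N by rewrite Dk1 (@dvdn_mul 2 2).
  have k3 : (3 %| k)%N by apply: (dvdn_prime_cofactor _ _ (2 * b)) => //; rewrite mulnA.
  have /dvdnP[d Dk] : (12 %| k)%N by rewrite (@Gauss_dvd 3 4) // k3.
  have d0 : (0 < d)%N by move: k0; rewrite Dk muln_gt0 andbT.
  have /dvdnP[a' Da] : (3 * d %| a)%N by rewrite -(@dvdn_pmul2l 4) // mulnA mulnC -Dk -(mulnA 2 2 a).
  have /dvdnP[b' Db] : (2 * d %| b)%N by rewrite -(@dvdn_pmul2l 6) // mulnA mulnC -Dk.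
  move: a2 b2 b3; rewrite Da Db Dk (mulnC d) !mulnA !dvdn_pmul2r // => a2 b2 b3.
  have ? : (~~ (2 %| a'))%N by lia.
  have ? : (~~ (3 %| b'))%N by lia.
  have ? : (~~ (2 %| b'))%N by lia.
  rewrite orbA; apply/orP; right; rewrite rule_arises_mul //.
  have ha : (a' * 3 %% 12 = 3 \/ a' * 3 %% 12 = 9)%N by lia.
  have hb : (b' * 2 %% 12 = 2 \/ b' * 2 %% 12 = 10)%N by lia.
  by case: ha => ->; case: hb => ->.
have [u5 u1] := tr_golden _ (z0 a) Ua.
have a1 : ~~ (k %| a)%N by rewrite dvE.
have a5 : (k %| 5 * a)%N by rewrite dvE mulnC exprM u5.
have k5 : (5 %| k)%N by apply: (dvdn_prime_cofactor _ _ a).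
(* From U^2 + U = 1, V = U + 1 = - (U^2 - 2). So v is - u^2 or its inverse, which ties the residue
   of [b] to that of [a]. *)
have E : tr (z ^+ b) = tr (- (z ^+ a) ^+ 2).
  rewrite trN tr_sqr // Vb -[X in _ = - (_ - (X + 1))]Ua; ring.
have v5 : (z ^+ b) ^+ 5 = -1.
  have u10 : (- (z ^+ a) ^+ 2) ^+ 5 = -1 by rewrite exprNn (exprAC (z ^+ a)) u5 expr1n mulr1 -signr_odd.
  have [|->//|vu] := tr_inj _ _ (z0 b) _ E; first by rewrite oppr_eq0 expf_neq0.
  have := expr1n algC 5; rewrite -{1}vu exprMn u10 mulrN1 => /eqP.
  by rewrite eqr_oppLR => /eqP.
have b5 : ~~ (k %| 5 * b)%N by rewrite dvE mulnC exprM v5.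
have b10 : (k %| 2 * (5 * b))%N by rewrite dvE (_ : 2 * (5 * b) = b * 5 * 2)%N ?exprM ?v5 ?sqrrN ?expr1n //; lia.
have k2 : (2 %| k)%N by apply: (dvdn_prime_cofactor _ _ (5 * b)).
have zh : z ^+ k./2 = -1 by apply: prim_half => //; rewrite -dvdn2 k2.
have /dvdnP[d Dk] : (10 %| k)%N by rewrite (@Gauss_dvd 2 5) // k2.
have d0 : (0 < d)%N by move: k0; rewrite Dk muln_gt0 andbT.
have /dvdnP[a' Da] : (2 * d %| a)%N by rewrite -(@dvdn_pmul2l 5) // mulnA mulnC -Dk.
have /dvdnP[b' Db] : (d %| b)%N by rewrite -(@dvdn_pmul2l 10) // mulnC -Dk -(mulnA 2 5 b).
(* With -1 = z^(5 d), a = 2 d a' and b = d b', these are v = - u^2 and v u^2 = -1 read off the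
   exponents. *)
have Eab : ((b' + 5 = 4 * a' %[mod 10]) \/ (b' + 4 * a' = 5 %[mod 10]))%N.
  have kh : k./2 = (5 * d)%N by lia.
  have [|vu|vu] := tr_inj _ _ (z0 b) _ E; [by rewrite oppr_eq0 expf_neq0| |].
    left; apply/eqP; rewrite -(@eqn_pmul2r d) // !muln_modl -(mulnC d 10) -Dk.
    rewrite -(eq_prim_root_expr pz) mulnDl exprD -Db -kh zh vu mulrN1 opprK.
    by rewrite -exprM; apply/eqP; congr (_ ^+ _); lia.
  right; apply/eqP; rewrite -(@eqn_pmul2r d) // !muln_modl -(mulnC d 10) -Dk.
  rewrite -(eq_prim_root_expr pz) mulnDl exprD -Db -kh zh.
  have -> : z ^+ (4 * a' * d) = (z ^+ a) ^+ 2 by rewrite -exprM; congr (_ ^+ _); lia.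
  by rewrite -[_ * _]opprK -mulrN vu.
move: a1 b5; rewrite Da Db Dk (mulnC d) !mulnA !dvdn_pmul2r // => a1 b5.
have ? : (~~ (5 %| a'))%N by lia.
have ? : (~~ (2 %| b'))%N by lia.
rewrite orbCA; apply/orP; left; rewrite rule_arises_mul //.
have : [|| a' %% 5 == 1, a' %% 5 == 2, a' %% 5 == 3 | a' %% 5 == 4]%N by lia.
case/or4P=> /eqP a5m.
- have -> : (a' * 2 %% 10 = 2)%N by lia.
  by have [|] : (b' %% 10 = 1 \/ b' %% 10 = 9)%N by [case: Eab; lia]; move=> ->.
- have -> : (a' * 2 %% 10 = 4)%N by lia.
  by have [|] : (b' %% 10 = 3 \/ b' %% 10 = 7)%N by [case: Eab; lia]; move=> ->.
- have -> : (a' * 2 %% 10 = 6)%N by lia.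
  by have [|] : (b' %% 10 = 3 \/ b' %% 10 = 7)%N by [case: Eab; lia]; move=> ->.
- have -> : (a' * 2 %% 10 = 8)%N by lia.
  by have [|] : (b' %% 10 = 1 \/ b' %% 10 = 9)%N by [case: Eab; lia]; move=> ->.
Qed.

Lemma trX m (w : algC) i : m.-primitive_root w -> (i <= m)%N ->
  tr (w ^+ i) = w ^+ i + w ^+ (m - i).
Proof.
move=> pw le_im; rewrite /tr; congr (_ + _).
have w0 := prim_neq0 _ _ pw.
apply: (mulfI (expf_neq0 i w0)).
by rewrite divff ?expf_neq0 // -exprD subnKC // (prim_expr_order pw).
Qed.

(** If k = m d then z^d is a primitive m-th root, and only the residues of a / d and b / d modulo m
    count: a finite check over the list of pairs. *)
Lemma rule_arisesP m pairs a b k (z : algC) : (0 < m)%N -> k.-primitive_root z ->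
  (forall (w : algC) i j, m.-primitive_root w -> (i, j) \in pairs ->
     [&& (i < m)%N, (j < m)%N & w ^+ j + w ^+ (m - j) - (w ^+ i + w ^+ (m - i)) == 1]) ->
  rule_arises m pairs a b k -> tr (z ^+ b) - tr (z ^+ a) = 1.
Proof.
move=> m0 pz check /and5P[/dvdnP[d Dk]]; rewrite Dk mulnK // => d0.
move=> /dvdnP[a' ->] /dvdnP[b' ->]; rewrite !mulnK // => inp.
have pw : m.-primitive_root (z ^+ d).
  have := dvdn_prim_root pz (_ : m %| k)%N; rewrite Dk dvdn_mull // mulnK //.
  exact.
have := check _ _ _ pw inp => /and3P[lti ltj /eqP E].
by rewrite !(mulnC _ d) !exprM -(prim_expr_mod pw a') -(prim_expr_mod pw b') !(trX m) // ltnW.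
Qed.

Lemma trace_of_arises k (z : algC) a b : k.-primitive_root z ->
  arises a b k -> tr (z ^+ b) - tr (z ^+ a) = 1.
Proof.
have red (w : algC) n r : w ^+ n = -1 -> w ^+ (n + r) = - w ^+ r.
  by move=> wn; rewrite exprD wn mulN1r.
move=> pz /or3P[]; apply: rule_arisesP => // w i j pw.
- have w3 : w ^+ 3 = -1 := prim_half _ _ pw isT.
  have w1 : w + 1 != 0.
    by apply/eqP=> /eqP; rewrite addr_eq0 => /eqP Dw;
      have := prim_order_dvd pw 2; rewrite Dw sqrrN expr1n eqxx.
  (* Cancelling the factor w + 1 from w^3 + 1 = 0 leaves the cyclotomic relation, which reduces
     every power of w to a common basis. The other two moduli are treated alike. *)
  have w2 : w ^+ 2 = w - 1.
    have F : (w + 1) * w ^+ 2 - (w + 1) * (w - 1) = w ^+ 3 + 1 by ring.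
    by apply: (mulfI w1); apply/eqP; rewrite -subr_eq0 F w3 addNr.
  have w4 := red _ _ 1%N w3; have w5 := red _ _ 2 w3; have w6 := red _ _ 3 w3.
  rewrite w2 w3 /= in w4 w5 w6.
  by rewrite !inE !xpair_eqE => /or4P[]/andP[/eqP-> /eqP->] /=; apply/eqP;
    rewrite ?w6 ?w5 ?w4 ?w3 ?w2; ring.
- have w5 : w ^+ 5 = -1 := prim_half _ _ pw isT.
  have w1 : w + 1 != 0.
    by apply/eqP=> /eqP; rewrite addr_eq0 => /eqP Dw;
      have := prim_order_dvd pw 2; rewrite Dw sqrrN expr1n eqxx.
  have w4 : w ^+ 4 = w ^+ 3 - w ^+ 2 + w - 1.
    have F : (w + 1) * w ^+ 4 - (w + 1) * (w ^+ 3 - w ^+ 2 + w - 1) = w ^+ 5 + 1 by ring.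
    by apply: (mulfI w1); apply/eqP; rewrite -subr_eq0 F w5 addNr.
  have w6 := red _ _ 1%N w5; have w7 := red _ _ 2 w5; have w8 := red _ _ 3 w5; have w9 := red _ _ 4 w5.
  rewrite w4 /= in w6 w7 w8 w9.
  by rewrite !inE !xpair_eqE => /or4P[|||/or4P[|||/orP[]]]/andP[/eqP-> /eqP->] /=; apply/eqP;
    rewrite ?w9 ?w8 ?w7 ?w6 ?w5 ?w4; ring.
- have w6 : w ^+ 6 = -1 := prim_half _ _ pw isT.
  have w1 : w ^+ 2 + 1 != 0.
    by apply/eqP=> /eqP; rewrite addr_eq0 => /eqP Dw;
      have := prim_order_dvd pw 4; rewrite (exprM w 2 2) Dw sqrrN expr1n eqxx.
  have w4 : w ^+ 4 = w ^+ 2 - 1.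
    have F : (w ^+ 2 + 1) * w ^+ 4 - (w ^+ 2 + 1) * (w ^+ 2 - 1) = w ^+ 6 + 1 by ring.
    by apply: (mulfI w1); apply/eqP; rewrite -subr_eq0 F w6 addNr.
  have w8 := red _ _ 2 w6; have w9 := red _ _ 3 w6; have w10 := red _ _ 4 w6.
  rewrite w4 /= in w8 w9 w10.
  by rewrite !inE !xpair_eqE => /or4P[|||/or4P[|||/orP[]]]/andP[/eqP-> /eqP->] /=; apply/eqP;
    rewrite ?w10 ?w9 ?w8 ?w6 ?w4; ring.
Qed.

Lemma dvd_Phi_GT a b k : (0 < k)%N -> ('Phi_k %| GT a b) = arises a b k.
Proof.
move=> k0; have [z pz] := C_prim_root_exists k0.
rewrite (Phi_dvdpE _ _ _ pz) (root_GT _ _ _ (prim_neq0 _ _ pz)).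
apply/eqP/idP; first by move/(trace_classification _ _ _ _ pz)/(arises_of_trace _ _ _ _ pz).
exact: trace_of_arises.
Qed.

(** * Multiplicity of the cyclotomic factors *)

Lemma prime_mul_sqr_eq p x y : prime p -> (p * x ^ 2 = y ^ 2)%N -> y = 0%N.
Proof.
move=> pp E; case: (posnP y) => // y0; have x0 : (0 < x)%N.
  by case: (posnP x) E => // ->; rewrite muln0 => /esym/eqP; rewrite expn_eq0 andbT => /eqP y_0; rewrite y_0 in y0.
have := congr1 (logn p) E; rewrite lognM ?(prime_gt0 pp) ?expn_gt0 ?x0 // (lognX p x 2) (lognX p y 2).
by rewrite (logn_prime _ pp) eqxx; lia.
Qed.

Lemma mul_deriv_Xn (z : algC) n : z * ('X^n)^`().[z] = n%:R * z ^+ n.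
Proof.
rewrite derivXn hornerMn hornerXn mulr_natl; case: n => [|n] /=.
  by rewrite !mulr0n mulr0.
by rewrite mulrnAr -exprS.
Qed.

Lemma deriv_GT_num (z : algC) a b :
  z * (pZtoC (GT_num a b))^`().[z] =
  (a + 2 * b)%:R * z ^+ (a + 2 * b) + a%:R * z ^+ a
   - (2 * a + b)%:R * z ^+ (2 * a + b) - b%:R * z ^+ b - (a + b)%:R * z ^+ (a + b).
Proof.
have -> : pZtoC (GT_num a b) = 'X^(a + 2 * b) + 'X^a - 'X^(2 * a + b) - 'X^b - 'X^(a + b).
  by rewrite /GT_num !(rmorphD, rmorphN) /= !map_polyXn.
rewrite !(derivD, derivN).
by rewrite !(hornerD, hornerN) -!mul_deriv_Xn !(mulrDr, mulrN).
Qed.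

(** At a double root the derivative gives b (v - 1/v) = a (u - 1/u), and squaring yields b^2 (V^2 -
    4) = a^2 (U^2 - 4). At each of the possible trace values this contradicts positivity of [a] or
    [b], or the irrationality of the square root of 3 or of 5. *)
Lemma GT_squarefree_Phi a b k : (0 < a)%N -> (0 < b)%N -> (0 < k)%N ->
  ~~ ('Phi_k ^+ 2 %| GT a b).
Proof.
move=> a0 b0 k0; have [z pz] := C_prim_root_exists k0.
have z0 := prim_neq0 _ _ pz.
apply/negP => dv2.
have E : tr (z ^+ b) - tr (z ^+ a) = 1.
  apply: (trace_of_arises _ _ _ _ pz); rewrite -dvd_Phi_GT //.
  by apply: dvdp_trans dv2; rewrite expr2 dvdp_mulr.
have D0 : (pZtoC (GT_num a b))^`().[z] = 0.
  have /(dvdp_mulr 'X^(minn a b)) := dv2; rewrite GT_mulXn.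
  move/(Pdiv.IdomainMonic.dvdpP (monic_exp 2 (Cyclotomic_monic k))) => [q ->].
  have Pz : (pZtoC 'Phi_k).[z] = 0.
    by apply/eqP; rewrite -/(root _ _) -(Phi_dvdpE _ _ _ pz) dvdpp.
  by rewrite expr2 !rmorphM /= !derivM !(hornerD, hornerM) Pz; ring.
have := deriv_GT_num z a b; rewrite D0 mulr0.
rewrite !(mulnC 2) !natrD !natrM !exprD !exprM.
set u := z ^+ a in E *; set v := z ^+ b in E * => H.
have u0 : u != 0 by rewrite expf_neq0.
have v0 : v != 0 by rewrite expf_neq0.
have {}H : (a%:R + 2 * b%:R) * (u * v ^+ 2) + a%:R * u - (2 * a%:R + b%:R) * (u ^+ 2 * v)
    - b%:R * v - (a%:R + b%:R) * (u * v) = 0 by rewrite H; ring.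
have key : b%:R * (v - v^-1) = a%:R * (u - u^-1) :> algC.
  apply: (mulfI (mulf_neq0 u0 v0)); apply/eqP; rewrite -subr_eq0.
  have -> : u * v * (b%:R * (v - v^-1)) - u * v * (a%:R * (u - u^-1)) =
     ((a%:R + 2 * b%:R) * (u * v ^+ 2) + a%:R * u - (2 * a%:R + b%:R) * (u ^+ 2 * v)
      - b%:R * v - (a%:R + b%:R) * (u * v))
     - (a%:R + b%:R) * (u * v * (tr v - tr u - 1)).
    by rewrite /tr; field; rewrite u0 v0.
  by rewrite H E subrr !mulr0 subrr.
have sq : b%:R ^+ 2 * (tr v ^+ 2 - 4) = a%:R ^+ 2 * (tr u ^+ 2 - 4) :> algC.
  have diff x : x != 0 -> tr x ^+ 2 - 4 = (x - x^-1) ^+ 2.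
    by move=> x0; rewrite /tr; field.
  by rewrite !diff // -!exprMn key.
have intC (m n : int) : m%:~R = n%:~R :> algC -> m = n by apply: intr_inj.
have intq (m n x y : int) :
    (m * x ^+ 2 - n * y ^+ 2)%:~R = m%:~R * x%:~R ^+ 2 - n%:~R * y%:~R ^+ 2 :> algC.
  by rewrite rmorphB /= rmorphM rmorphXn rmorphM rmorphXn.
have [[] [Ua Vb]|[Ua Vb]] := trace_classification _ _ _ _ pz E; move: sq;
  rewrite -/u -/v in Ua Vb; rewrite ?Ua ?Vb => sq.
- have /intC : (3 * a%:Z ^+ 2)%:~R = 0%:~R :> algC.
    by apply: (eq0_of_eq _ _ _ sq); rewrite rmorphM rmorphXn /= natz; left; ring.
  nia.
- have /intC : (3 * b%:Z ^+ 2)%:~R = 0%:~R :> algC.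
    by apply: (eq0_of_eq _ _ _ sq); rewrite rmorphM rmorphXn /= natz; right; ring.
  nia.
- have /intC : (3 * a%:Z ^+ 2 - 4 * b%:Z ^+ 2)%:~R = 0%:~R :> algC.
    by apply: (eq0_of_eq _ _ _ sq); rewrite intq; left; ring.
  move=> E3; have := prime_mul_sqr_eq 3 a (2 * b) isT; lia.
- have /intC : (3 * b%:Z ^+ 2 - 4 * a%:Z ^+ 2)%:~R = 0%:~R :> algC.
    by apply: (eq0_of_eq _ _ _ sq); rewrite intq; right; ring.
  move=> E3; have := prime_mul_sqr_eq 3 b (2 * a) isT; lia.
(* Reducing by U^2 + U = 1 makes the relation linear in [U]. Completing the square in U^2 + U = 1
   then eliminates [U] and leaves 5 (b^2 - a^2)^2 = (a^2 + b^2)^2. *)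
have SU : (a%:R ^+ 2 + b%:R ^+ 2) * tr u = 2 * b%:R ^+ 2 - 3 * a%:R ^+ 2 :> algC.
  apply/eqP; rewrite -subr_eq0.
  have -> : (a%:R ^+ 2 + b%:R ^+ 2) * tr u - (2 * b%:R ^+ 2 - 3 * a%:R ^+ 2) =
    (b%:R ^+ 2 * ((tr u + 1) ^+ 2 - 4) - a%:R ^+ 2 * (tr u ^+ 2 - 4))
     - (b%:R ^+ 2 - a%:R ^+ 2) * (tr u ^+ 2 + tr u - 1) by ring.
  by rewrite sq Ua !subrr mulr0 subrr.
have /intC E5 : (5 * (b%:Z ^+ 2 - a%:Z ^+ 2) ^+ 2)%:~R = ((a%:Z ^+ 2 + b%:Z ^+ 2) ^+ 2)%:~R :> algC.
  have n5 : 5 != 0 :> algC by rewrite pnatr_eq0.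
  apply: (mulfI n5).
  have intl (x y : int) : (5 * (y - x) ^+ 2)%:~R = 5 * (y%:~R - x%:~R) ^+ 2 :> algC.
    by rewrite rmorphM rmorphXn rmorphB.
  have intr2 (x y : int) : ((x + y) ^+ 2)%:~R = (x%:~R + y%:~R) ^+ 2 :> algC.
    by rewrite rmorphXn rmorphD.
  rewrite intl intr2 !rmorphXn /=.
  set A : algC := a%:~R ^+ 2; set B : algC := b%:~R ^+ 2.
  have -> : 5 * (5 * (B - A) ^+ 2) =
    4 * (((A + B) * tr u) ^+ 2 + (A + B) * tr u * (A + B)) + (A + B) ^+ 2.
    by rewrite SU -/A -/B; ring.
  have -> : ((A + B) * tr u) ^+ 2 + (A + B) * tr u * (A + B) =
     (A + B) ^+ 2 * (tr u ^+ 2 + tr u) by ring.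
  by rewrite Ua; ring.
have [D HD] : exists D : nat, D%:Z ^+ 2 = (b%:Z ^+ 2 - a%:Z ^+ 2) ^+ 2.
  by exists `|b%:Z ^+ 2 - a%:Z ^+ 2|%N; rewrite abszE real_normK // num_real.
have := prime_mul_sqr_eq 5 D (a ^ 2 + b ^ 2) isT.
by rewrite -HD in E5; lia.
Qed.

(** * The product of the arising cyclotomic polynomials *)

Lemma dvdp_int_algC (p q : {poly int}) : (p %| q) = (pZtoC p %| pZtoC q).
Proof.
have ratrint (r : {poly int}) : pZtoC r = map_poly ratr (map_poly intr r : {poly rat}).
  by rewrite -map_poly_comp; apply: eq_map_poly => x /=; rewrite ratr_int.
by rewrite !ratrint dvdp_map dvdp_rat_int.
Qed.

Lemma dvdp_prod_Phi (N : nat) (P : pred nat) (p : {poly int}) :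
  (forall n, P n -> (0 < n)%N /\ 'Phi_n %| p) ->
  \prod_(n < N | P n) 'Phi_n %| p.
Proof.
move=> dv; elim: N => [|N IH]; first by rewrite big_ord0 dvd1p.
rewrite big_mkcond big_ord_recr -big_mkcond /=.
case: ifP => [PN|_]; last by rewrite mulr1.
have [N0 dvN] := dv _ PN.
move: IH dvN; rewrite !dvdp_int_algC rmorphM /= Gauss_dvdp; first by move=> -> ->.
rewrite rmorph_prod; apply: (big_ind (fun x => coprimep x _)) => [|x y cx cy|n Pn].
- exact: coprime1p.
- by rewrite coprimepMl cx.
have [z pz] := C_prim_root_exists N0.
have [z' pz'] := C_prim_root_exists (dv _ Pn).1.
rewrite /= (Cintr_Cyclotomic pz) (Cintr_Cyclotomic pz').
apply/Pdiv.ClosedField.coprimepP => x rx; apply/negP => rx'.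
have px : n.-primitive_root x by rewrite -(root_cyclotomic pz').
have px' : N.-primitive_root x by rewrite -(root_cyclotomic pz).
have := prim_order_dvd px' n; rewrite (prim_expr_order px) eqxx => /dvdn_leq.
by move/(_ (dv _ Pn).1); rewrite leqNgt ltn_ord.
Qed.

Lemma arises_dvd a b k : arises a b k ->
  exists2 m, m \in [:: 6; 10; 12]%N & exists d, [/\ k = (m * d)%N, (0 < d)%N, (d %| a)%N & (d %| b)%N].
Proof.
move=> /or3P[] /and5P[/dvdnP[d Dk]]; rewrite Dk mulnK // => d0 da db _;
 [exists 6%N | exists 10%N | exists 12%N] => //; exists d; by rewrite mulnC.
Qed.

Lemma arises_gt0 a b k : arises a b k -> (0 < k)%N.
Proof.
by move=> /arises_dvd[m]; rewrite !inE => /or3P[]/eqP-> [d [-> d0 _ _]]; rewrite muln_gt0.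
Qed.

Lemma CT_monic a b : CT a b \is monic.
Proof. by apply: monic_prod => n _; apply: Cyclotomic_monic. Qed.

Lemma dvd_CT a b : CT a b %| GT a b.
Proof.
by apply: dvdp_prod_Phi => n an; rewrite dvd_Phi_GT ?(arises_gt0 _ _ _ an).
Qed.

Lemma divCTK a b : GT a b %/ CT a b * CT a b = GT a b.
Proof.
have /eqP m0 := dvd_CT a b.
by rewrite [RHS](Pdiv.IdomainMonic.divp_eq (CT_monic a b)) m0 addr0.
Qed.

Lemma Phi_dvd_CT a b k : (0 < a)%N -> arises a b k -> 'Phi_k %| CT a b.
Proof.
move=> a0 ak.
have lek : (k < (12 * (a + b)).+1)%N.
  have [m mP [d [-> _ /(dvdn_leq a0) da _]]] := arises_dvd _ _ _ ak.
  by rewrite ltnS; move: mP; rewrite !inE => /or3P[]/eqP->; lia.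
by rewrite /CT (bigD1 (Ordinal lek)) //= dvdp_mulr.
Qed.

(** If ['Phi_k] divided the quotient, it would divide [GT], hence also [CT], and so occur twice in
    [GT]. *)
Lemma GT_div_CT_no_Phi a b k : (0 < a)%N -> (0 < b)%N -> (0 < k)%N ->
  ~~ ('Phi_k %| GT a b %/ CT a b).
Proof.
move=> a0 b0 k0; apply/negP => dv.
have ak : arises a b k.
  by rewrite -dvd_Phi_GT // -divCTK dvdp_mulr.
have := GT_squarefree_Phi _ _ _ a0 b0 k0.
by rewrite -divCTK expr2 dvdp_mul // Phi_dvd_CT.
Qed.

(** With g = gcd(a, b), every factor divides x^(6 g) - 1, x^(10 g) - 1 or x^(12 g) - 1, and 28 = 6 +
    10 + 12. This keeps GT / CT nonconstant in (c). *)
Lemma size_CT a b : (0 < a)%N -> (size (CT a b) <= (28 * gcdn a b).+1)%N.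
Proof.
move=> a0; set g := gcdn a b; have g0 : (0 < g)%N by rewrite gcdn_gt0 a0.
pose p : {poly int} := ('X^(6 * g) - 1) * ('X^(10 * g) - 1) * ('X^(12 * g) - 1).
have dv : CT a b %| p.
  apply: dvdp_prod_Phi => n an; have n0 := arises_gt0 _ _ _ an; split=> //.
  have dvX m d : n = (m * d)%N -> (d %| g)%N -> 'Phi_n %| 'X^(m * g) - 1.
    move=> Dn dg; have [z pz] := C_prim_root_exists n0.
    rewrite (Phi_dvdpE _ _ _ pz) rmorphB rmorph1 /= map_polyXn.
    by rewrite /root !(hornerE, hornerXn) subr_eq0 -(prim_order_dvd pz) Dn dvdn_mul.
  have [m mP [d [Dn d0 da db]]] := arises_dvd _ _ _ an.
  have dg : (d %| g)%N by rewrite dvdn_gcd da.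
  have := dvX _ _ Dn dg; rewrite /p; move: mP; rewrite !inE => /or3P[]/eqP-> h.
  - by rewrite -mulrA dvdp_mulr.
  - by rewrite mulrAC dvdp_mull.
  - by rewrite dvdp_mull.
have n0 m : (0 < m)%N -> ('X^m - 1 : {poly int}) != 0.
  by move=> m0; rewrite -size_poly_eq0 size_XnsubC.
have p0 : p != 0 by rewrite !mulf_neq0 // n0 // muln_gt0.
apply: leq_trans (dvdp_leq p0 dv) _.
by rewrite !size_mul ?mulf_neq0 ?n0 ?muln_gt0 // !size_XnsubC ?muln_gt0 //; lia.
Qed.

Lemma part_a a b : (0 < a)%N -> (0 < b)%N ->
     [/\ CT a b %| GT a b,
         (forall k, (0 < k)%N -> 'Phi_k %| CT a b -> ~~ ('Phi_k ^+ 2 %| GT a b)) &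
         (forall k, (0 < k)%N -> ~~ ('Phi_k %| GT a b %/ CT a b))].
Proof.
move=> a0 b0; split; first exact: dvd_CT.
  by move=> k k0 _; apply: GT_squarefree_Phi.
by move=> k k0; apply: GT_div_CT_no_Phi.
Qed.

(** * Reciprocal factors *)

(** Autocorrelation at lag d of 1 + s1 x^w1 + s2 x^w2 + s3 x^w3 + x^N, one term for each pair of
    exponents; [P5_corr] identifies it with a coefficient of W W*. *)
Definition corr5 (s1 s2 s3 : int) (N w1 w2 w3 d : nat) : int :=
  let b (x : nat) : int := (x == d)%:Z in
  s1 * b w1 + s2 * b w2 + s3 * b w3 + b N + s1 * s2 * b (w2 - w1)%N + s1 * s3 * b (w3 - w1)%N
  + s1 * b (N - w1)%N + s2 * s3 * b (w3 - w2)%N + s2 * b (N - w2)%N + s3 * b (N - w3)%N.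

Ltac decide_eqn H he h1 h2 h3 :=
  repeat match type of H with context [Posz (nat_of_bool (?x == ?y :> nat))] =>
    first [ rewrite (_ : Posz (nat_of_bool (x == y)) = 0) in H;
              last by (clear H he h1 h2 h3; have -> : (x == y) = false by lia)
          | rewrite (_ : Posz (nat_of_bool (x == y)) = 1) in H;
              last by (clear H he h1 h2 h3; have -> : (x == y) = true by lia) ] end;
  rewrite ?(mulr0, mulr1, addr0, add0r) in H.

(** On the right, the largest lag below 2 m that occurs is m + n, with value -2. On the left the
    largest candidates are w3 and 2 m - w1. *)
Lemma corr5_inj (m n : nat) (e s1 s2 s3 : int) (w1 w2 w3 : nat) :
  (0 < n < m)%N -> (0 < w1 < w2)%N -> (w2 < w3 < 2 * m)%N ->
  e = 1 \/ e = -1 -> s1 = 1 \/ s1 = -1 -> s2 = 1 \/ s2 = -1 -> s3 = 1 \/ s3 = -1 ->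
  (forall d, (0 < d)%N -> corr5 s1 s2 s3 (2 * m) w1 w2 w3 d = corr5 (-1) e (-1) (2 * m) (m - n) m (m + n) d) ->
  [/\ w1 = m - n, w2 = m & w3 = m + n]%N /\ [/\ s1 = -1, s2 = e & s3 = -1].
Proof.
rewrite /corr5 /= => nm w12 w23 he h1 h2 h3 H.
have m0 : (0 < m)%N by lia.
have H_mn : (0 < m + n)%N by lia.
have H_w3 : (0 < w3)%N by lia.
have H_w1 : (0 < 2 * m - w1)%N by lia.
have H_w2 : (0 < w2)%N by lia.
have H_w2' : (0 < 2 * m - w2)%N by lia.
(* If w3 and 2 m - w1 differ, the larger one is attained by a single pair and has correlation 1 or
   -1, whereas the right side has only 0 from there up to 2 m and -2 at m + n. *)
have [lt|lt|eq] := ltngtP (2 * m)%N (w1 + w3)%N.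
- exfalso; have [lt2|lt2|eq2] := ltngtP w3 (m + n)%N.
  + by move: (H _ H_mn) => {}H; decide_eqn H he h1 h2 h3.
  + by move: (H _ H_w3) => {}H; decide_eqn H he h1 h2 h3; lia.
  + by move: (H _ H_mn) => {}H; decide_eqn H he h1 h2 h3; lia.
- exfalso; have [lt2|lt2|eq2] := ltngtP (2 * m - w1)%N (m + n)%N.
  + by move: (H _ H_mn) => {}H; decide_eqn H he h1 h2 h3.
  + by move: (H _ H_w1) => {}H; decide_eqn H he h1 h2 h3; lia.
  + by move: (H _ H_mn) => {}H; decide_eqn H he h1 h2 h3; lia.
(* The two pairs at lag w3 = 2 m - w1 contribute s1 + s3. If they agree, w3 = m + n and both signs
   are -1; a w2 other than m would leave the lag max(w2, 2 m - w2) unmatched. *)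
have [s13|s13] : s1 = s3 \/ s1 = - s3 by clear H; lia.
  have E3 : w3 = (m + n)%N.
    have [lt2|lt2|//] := ltngtP w3 (m + n)%N; exfalso.
      by move: (H _ H_mn) => {}H; decide_eqn H he h1 h2 h3.
    by move: (H _ H_w3) => {}H; decide_eqn H he h1 h2 h3; lia.
  have E1 : w1 = (m - n)%N by clear H; lia.
  have S3 : s3 = -1 by move: (H _ H_mn) => {}H; decide_eqn H he h1 h2 h3; lia.
  have E2 : w2 = m.
    have [lt2|lt2|//] := ltngtP w2 m; exfalso.
      by move: (H _ H_w2') => {}H; decide_eqn H he h1 h2 h3; lia.
    by move: (H _ H_w2) => {}H; decide_eqn H he h1 h2 h3; lia.
  split; split=> //; first by rewrite s13.
  by have [E|E] := eqVneq (2 * n)%N m; move: (H _ m0) => {}H; decide_eqn H he h1 h2 h3; lia.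
(* If they cancel, the value -2 at lag m + n has to come from the remaining pairs. Every way to
   reach it fails, at lag m + n itself or at lag m. *)
exfalso.
have [A|A] := eqVneq (w3 - w1)%N (m + n)%N; last first.
  move: (H _ H_mn) => {}H.
  have [B|B] := eqVneq w3 (m + n)%N; have [C|C] := eqVneq w2 (m + n)%N;
  have [D|D] := eqVneq w2 (m - n)%N; have [E|E] := eqVneq (w2 - w1)%N (m + n)%N;
  have [F|F] := eqVneq (w3 - w2)%N (m + n)%N; try (clear H he h1 h2 h3; lia);
  by decide_eqn H he h1 h2 h3; lia.
have [C|C] := eqVneq w2 (m + n)%N.
  by have [E|E] := eqVneq (2 * n)%N m; move: (H _ m0) => {}H;
     have [F|F] := eqVneq (w2 - w1)%N m; decide_eqn H he h1 h2 h3; lia.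
have [D|D] := eqVneq w2 (m - n)%N.
  by have [E|E] := eqVneq (2 * n)%N m; move: (H _ m0) => {}H;
     have [F|F] := eqVneq (w3 - w2)%N m; decide_eqn H he h1 h2 h3; lia.
move: (H _ H_mn) => {}H.
have [E|E] := eqVneq (w2 - w1)%N (m + n)%N; have [F|F] := eqVneq (w3 - w2)%N (m + n)%N;
  decide_eqn H he h1 h2 h3; lia.
Qed.

(** The reversal x^n p(1/x) at a nominal degree n instead of the actual one, which makes it
    additive. *)
Definition revp (n : nat) (p : {poly int}) : {poly int} := \poly_(i < n.+1) p`_(n - i).

Lemma coef_revp n p i : (revp n p)`_i = if (i <= n)%N then p`_(n - i) else 0.
Proof. by rewrite coef_poly ltnS. Qed.

Lemma revpD n p q : revp n (p + q) = revp n p + revp n q.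
Proof.
by apply/polyP=> i; rewrite !(coef_revp, coefD); case: ifP => // _; rewrite addr0.
Qed.

Lemma revpZ n c p : revp n (c *: p) = c *: revp n p.
Proof.
by apply/polyP=> i; rewrite !(coef_revp, coefZ); case: ifP => // _; rewrite mulr0.
Qed.

Lemma revpXn n k : (k <= n)%N -> revp n 'X^k = 'X^(n - k).
Proof.
move=> kn; apply/polyP=> i; rewrite coef_revp !coefXn.
case: leqP => lt; last by rewrite gtn_eqF //; lia.
by congr (_%:R); congr nat_of_bool; lia.
Qed.

Lemma revpMX n p : revp n.+1 (p * 'X) = revp n p.
Proof.
apply/polyP=> i; rewrite !coef_revp coefMX.
have [lt|lt|->] := ltngtP i n.+1; last by rewrite ltnn subnn.
  by rewrite -ltnS lt subn_eq0 leqNgt lt subSn.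
by rewrite leqNgt (ltnW lt).
Qed.

Lemma revp_shift k n (p : {poly int}) : (size p <= n.+1)%N -> revp (k + n) p = 'X^k * revp n p.
Proof.
move=> sp; apply/polyP=> i; rewrite mulrC coefMXn !coef_revp.
have [lt|le] := ltnP i k.
  rewrite ifT; last by lia.
  by rewrite nth_default //; apply: leq_trans sp _; lia.
have -> : (i <= k + n)%N = (i - k <= n)%N by lia.
by case: ifP => // _; congr (_`_ _); lia.
Qed.

Lemma revpM n m (p q : {poly int}) : (size p <= n.+1)%N -> (size q <= m.+1)%N ->
  revp (n + m) (p * q) = revp n p * revp m q.
Proof.
elim: n p => [|n IH] p sp sq.
  rewrite [p]size1_polyC // mul_polyC revpZ.
  have -> : revp 0 (p`_0)%:P = (p`_0)%:P.
    by apply/polyP=> -[|i]; rewrite coef_revp !coefC.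
  by rewrite mul_polyC.
have [r [c Dp]] : exists r : {poly int}, exists c, p = r * 'X + c%:P.
  by elim/poly_ind: p {sp} => [|r c _]; [exists 0, 0; rewrite mul0r add0r polyC0 | exists r, c].
have sr : (size r <= n.+1)%N.
  have [->|r0] := eqVneq r 0; first by rewrite size_poly0.
  by move: sp; rewrite Dp size_MXaddC (negPf r0).
have sc : (size (c%:P : {poly int}) <= 1)%N by apply: size_polyC_leq1.
rewrite Dp mulrDl !revpD mulrAC revpMX mulrDl -IH // revpMX; congr (_ + _).
rewrite mul_polyC revpZ -{1}[n.+1]addn0 -addnA revp_shift // -mul_polyC mulrA.
congr (_ * _); rewrite -[n.+1]addn0 revp_shift //.
have -> : revp 0 c%:P = c%:P by apply/polyP=> -[|i]; rewrite coef_revp !coefC.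
by rewrite addn0 mulrC.
Qed.

Lemma revpK n (p : {poly int}) : (size p <= n.+1)%N -> revp n (revp n p) = p.
Proof.
move=> sp; apply/polyP=> i; rewrite !coef_revp leq_subr.
by case: leqP => [le|lt]; [rewrite subKn | rewrite nth_default //; apply: leq_trans sp _].
Qed.

(** This is the constant term of W(x) W(1/x). *)
Lemma coef_mul_revp N (W : {poly int}) : (W * revp N W)`_N = \sum_(i < N.+1) W`_i ^+ 2.
Proof.
rewrite coefM; apply: eq_bigr => i _.
by rewrite coef_revp leq_subr subKn ?expr2 // -ltnS.
Qed.

Definition sparse (l : seq (int * nat)) : {poly int} := \sum_(t <- l) t.1 *: 'X^(t.2).

Lemma sparse_corr l N d : all (fun t : int * nat => (t.2 <= N)%N) l -> (0 < d)%N ->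
  (sparse l * revp N (sparse l))`_(N + d) =
  \sum_(t <- l) \sum_(t' <- l) t.1 * t'.1 * ((t.2 - t'.2)%N == d)%:Z.
Proof.
move=> /allP lN d0.
have -> : revp N (sparse l) = \sum_(t <- l) t.1 *: 'X^(N - t.2).
  rewrite /sparse big_seq [RHS]big_seq.
  elim/big_rec2: _ => [|t x y tl <-].
    by apply/polyP=> i; rewrite coef_revp !coef0 if_same.
  by rewrite revpD revpZ revpXn // lN.
rewrite mulr_suml coef_sum; apply: eq_bigr => t _.
rewrite mulr_sumr coef_sum big_seq [RHS]big_seq; apply: eq_bigr => t' t'l.
rewrite -scalerAl -scalerAr scalerA coefZ -exprD coefXn natz; congr (_ * Posz (nat_of_bool _)).
by have := lN _ t'l; lia.
Qed.

Definition P5 (s1 s2 s3 : int) (N w1 w2 w3 : nat) : {poly int} :=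
  sparse [:: (1, 0%N); (s1, w1); (s2, w2); (s3, w3); (1, N)].

Lemma P5_corr s1 s2 s3 N w1 w2 w3 d :
  (w1 <= w2 <= w3)%N -> (w3 <= N)%N -> (0 < d)%N ->
  (P5 s1 s2 s3 N w1 w2 w3 * revp N (P5 s1 s2 s3 N w1 w2 w3))`_(N + d) =
  corr5 s1 s2 s3 N w1 w2 w3 d.
Proof.
move=> w123 w3N d0.
rewrite sparse_corr //=; last by apply/and5P; split; lia.
rewrite !big_cons !big_nil /= /corr5 !subn0 !subnn.
have z x y : (x <= y)%N -> (x - y = 0)%N by lia.
have d00 : (0%N == d) = false by lia.
have [e12 e13 e1N] : [/\ w1 - w2 = 0, w1 - w3 = 0 & w1 - N = 0]%N by split; apply: z; lia.
have [e23 e2N e3N] : [/\ w2 - w3 = 0, w2 - N = 0 & w3 - N = 0]%N by split; apply: z; lia.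
rewrite -> e12, e13, e1N, e23, e2N, e3N, !sub0n.
rewrite d00.
change (Posz (nat_of_bool false)) with (0 : int).
repeat match goal with |- context [Posz (nat_of_bool ?b)] =>
  generalize (Posz (nat_of_bool b)); intro end.
by ring.
Qed.

Lemma P5_sumsq s1 s2 s3 N w1 w2 w3 :
  (0 < w1 < w2)%N -> (w2 < w3 < N)%N ->
  \sum_(i < N.+1) (P5 s1 s2 s3 N w1 w2 w3)`_i ^+ 2 = 2 + s1 ^+ 2 + s2 ^+ 2 + s3 ^+ 2.
Proof.
move=> w12 w23.
rewrite /P5 /sparse !big_cons big_nil /=.
pose f (i : nat) : int := (i == 0%N)%:Z + s1 ^+ 2 * (i == w1)%:Z + s2 ^+ 2 * (i == w2)%:Z
  + s3 ^+ 2 * (i == w3)%:Z + (i == N)%:Z.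
rewrite (eq_bigr (fun i : 'I_N.+1 => f i)) => [|i _]; last first.
  rewrite !coefD !coefZ !coefXn coef0 !natz /f.
  have [->|?] := eqVneq (i : nat) 0%N; first by rewrite !ltn_eqF /= ?mulr0; [ring|lia..].
  have [->|?] := eqVneq (i : nat) w1; first by rewrite !ltn_eqF /= ?mulr0; [ring|lia..].
  have [->|?] := eqVneq (i : nat) w2; first by rewrite !ltn_eqF /= ?mulr0; [ring|lia..].
  have [->|?] := eqVneq (i : nat) w3; first by rewrite !ltn_eqF /= ?mulr0; [ring|lia..].
  by case: eqP => _ /=; ring.
have sum1 c w : (w < N.+1)%N -> \sum_(i < N.+1) c * ((i : nat) == w)%:Z = c :> int.
  move=> wN; rewrite (bigD1 (Ordinal wN)) //= eqxx mulr1 big1 ?addr0 // => i.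
  by rewrite -val_eqE /= => /negPf->; rewrite mulr0.
have sum1' w : (w < N.+1)%N -> \sum_(i < N.+1) ((i : nat) == w)%:Z = 1 :> int.
  by move=> wN; rewrite -[RHS](sum1 1 w wN); apply: eq_bigr => i _; rewrite mul1r.
rewrite /f !big_split /= !sum1 ?sum1' //; lia.
Qed.

Lemma sqr_sum3 (l : seq int) : all (fun x => x != 0) l -> \sum_(x <- l) x ^+ 2 = 3 ->
  exists x y z, [/\ l = [:: x; y; z], x ^+ 2 = 1, y ^+ 2 = 1 & z ^+ 2 = 1].
Proof.
have pos (l' : seq int) : 0 <= \sum_(x <- l') x ^+ 2 by apply: sumr_ge0 => x _; apply: sqr_ge0.
have ge1 (x : int) : x != 0 -> 1 <= x ^+ 2 by move=> x0; nia.
have gap (x : int) : x ^+ 2 <= 1 \/ 4 <= x ^+ 2.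
  have [h|[h|h]] : x <= -2 \/ 2 <= x \/ (-1 <= x <= 1) by lia.
  - by right; nia.
  - by right; nia.
  - by left; have [->|[->|->]] : x = -1 \/ x = 0 \/ x = 1 by lia.
case: l => [_|x l /= /andP[/ge1 x0]]; first by rewrite big_nil.
have gx := gap x.
rewrite big_cons; case: l => [_|y l /= /andP[/ge1 y0]]; first by rewrite big_nil; lia.
have gy := gap y.
rewrite big_cons; case: l => [_|z l /= /andP[/ge1 z0]]; first by rewrite big_nil; lia.
rewrite big_cons; case: l => [_|t l /= /andP[/ge1 t0 _]].
  by rewrite big_nil => E; exists x, y, z; split=> //; lia.
by rewrite big_cons; move: (pos l); set S := \sum_(_ <- l) _ => S0; lia.
Qed.
Lemma big_ends (V : nmodType) N (F : nat -> V) : (0 < N)%N ->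
  \sum_(i < N.+1) F i = F 0%N + \sum_(i <- index_iota 1 N) F i + F N.
Proof. by move=> N0; rewrite -(big_mkord xpredT F) big_nat_recr // big_ltn. Qed.

(** The end coefficients are equal units and use up 2 of the 5; three nonzero squares, each equal to
    1, remain for the interior. *)
Lemma eq_P5_of_sumsq N (W : {poly int}) : (0 < N)%N -> (size W <= N.+1)%N ->
  W`_0 * W`_N = 1 -> \sum_(i < N.+1) W`_i ^+ 2 = 5 ->
  exists s s1 s2 s3 : int, exists w1 w2 w3, 
   [/\ s ^+ 2 = 1, s1 ^+ 2 = 1, s2 ^+ 2 = 1 & s3 ^+ 2 = 1] /\
   [/\ (0 < w1 < w2)%N, (w2 < w3 < N)%N & W = s *: P5 s1 s2 s3 N w1 w2 w3].
Proof.
move=> N0 sW W0N; rewrite (big_ends _ _ (fun i => W`_i ^+ 2)) //.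
have [WN W02] : W`_N = W`_0 /\ W`_0 ^+ 2 = 1.
  have : W`_0 \is a GRing.unit by apply/unitrP; exists W`_N; rewrite mulrC W0N.
  by rewrite unfold_in /= => /orP[]/eqP E; move: (W`_N) W0N => x;
    rewrite E ?mul1r ?mulN1r => Ex; split=> //; lia.
rewrite WN W02; set l := index_iota 1 N => Esum.
pose supp := [seq i <- l | W`_i != 0].
have big_supp (V : zmodType) (F : nat -> V) :
    (forall i, W`_i = 0 -> F i = 0) -> \sum_(i <- l) F i = \sum_(i <- supp) F i.
  move=> F0; rewrite big_filter [RHS]big_mkcond; apply: eq_bigr => i _.
  by case: eqP => //= /F0.
have [||x [y [z [Dl x1 y1 z1]]]] := sqr_sum3 [seq W`_i | i <- supp].
- by rewrite all_map; apply/allP=> i; rewrite mem_filter => /andP[].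
- rewrite big_map -(big_supp _ (fun i => W`_i ^+ 2)); last by move=> i ->; rewrite expr0n.
  by move: Esum; set S := \sum_(_ <- _) _ => ?; lia.
have sorted_supp : sorted ltn supp.
  by apply: sorted_filter; [exact: ltn_trans | exact: iota_ltn_sorted].
have in_supp i : i \in supp -> (0 < i < N)%N by rewrite mem_filter mem_index_iota => /andP[].
have DW : W = W`_0 *: 'X^0 + \sum_(i <- supp) W`_i *: 'X^i + W`_N *: 'X^N.
  rewrite -(big_supp _ (fun i => W`_i *: 'X^i)); last by move=> i ->; rewrite scale0r.
  rewrite -(big_ends _ _ (fun i => W`_i *: 'X^i)) //.
  apply/polyP=> i; rewrite coef_sum; have [lt|ge] := ltnP i N.+1.
    rewrite (bigD1 (Ordinal lt)) //= coefZ coefXn eqxx mulr1 big1 ?addr0 // => j.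
    by rewrite -val_eqE /= coefZ coefXn eq_sym => /negPf->; rewrite mulr0.
  rewrite nth_default; last exact: leq_trans sW ge.
  rewrite big1 // => j _; rewrite coefZ coefXn gtn_eqF ?mulr0 //.
  exact: leq_trans (ltn_ord j) ge.
move: Dl DW sorted_supp in_supp; case: supp {big_supp} => [|w1 [|w2 [|w3 [|? ?]]]] //= [Dx Dy Dz] DW.
move=> /and3P[w12 w23 _] in_supp.
exists W`_0, (W`_0 * x), (W`_0 * y), (W`_0 * z), w1, w2, w3; split.
  by rewrite !exprMn W02 x1 y1 z1; split; lia.
have i1 := in_supp w1 (mem_head _ _).
have i3 : (0 < w3 < N)%N by apply: in_supp; rewrite !inE eqxx !orbT.
split; [lia|lia|].
rewrite {1}DW /P5 /sparse !big_cons !big_nil /= Dx Dy Dz WN.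
rewrite !scalerDr !scalerA !mulrA -expr2 W02 !mul1r !mulr1 scaler0 !addrA !addr0.
by [].
Qed.

(** x^m (x^m + x^-m + e - x^n - x^-n): the common shape of [GT] for both orders of [a] and [b], with
    e = -1 when a < b. *)
Definition quinom (e : int) (m n : nat) : {poly int} := P5 (-1) e (-1) (2 * m) (m - n) m (m + n).

Lemma quinomE e m n :
  quinom e m n = 1 - 'X^(m - n) + e *: 'X^m - 'X^(m + n) + 'X^(2 * m).
Proof.
rewrite /quinom /P5 /sparse !big_cons big_nil /= expr0 !scale1r !scaleN1r.
by rewrite addr0 !addrA.
Qed.

Lemma GT_quinom a b : a <> b ->
  exists s e : int, [/\ s = 1 \/ s = -1, e = 1 \/ e = -1 &
    GT a b = s *: quinom e (maxn a b) (minn a b)].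
Proof.
case: (ltngtP a b) => // lt _.
  exists 1, (-1); split; [by left|by right|].
  by rewrite GT_gt // quinomE scale1r scaleN1r; ring_Xn.
exists (-1), 1; split; [by right|by left|].
by rewrite GT_lt // quinomE scale1r scaleN1r; ring_Xn.
Qed.

Lemma minn_lt_maxn a b : (0 < a)%N -> (0 < b)%N -> a <> b -> (0 < minn a b < maxn a b)%N.
Proof. by case: (ltngtP a b) => // lt a0 b0 _; rewrite ?a0 ?b0. Qed.

Section TrinomFactor.

Variables (e : int) (m n : nat).
Hypotheses (he : e = 1 \/ e = -1) (nm : (0 < n < m)%N).

Let P := quinom e m n.

Lemma coef_quinom i : P`_i =
  (i == 0%N)%:Z - (i == (m - n)%N)%:Z + e * (i == m)%:Z - (i == (m + n)%N)%:Z + (i == (2 * m)%N)%:Z.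
Proof. by rewrite /P quinomE !(coefD, coefN, coefZ, coefXn, coef1) !natz. Qed.

Lemma size_quinom : size P = (2 * m).+1.
Proof.
apply/eqP; rewrite eqn_leq; apply/andP; split.
  apply/leq_sizeP => j lt; rewrite coef_quinom.
  rewrite (_ : (j == 0%N) = false) 1?(_ : (j == (m - n)%N) = false); [|lia..].
  rewrite (_ : (j == m) = false) 1?(_ : (j == (m + n)%N) = false); [|lia..].
  by rewrite (_ : (j == (2 * m)%N) = false) ?mulr0 //; lia.
rewrite ltnNge; apply/negP => /leq_sizeP/(_ (2 * m)%N (leqnn _)).
rewrite coef_quinom eqxx.
rewrite (_ : (2 * m == 0)%N = false) 1?(_ : (2 * m == m - n)%N = false); [|lia..].
by rewrite (_ : (2 * m == m)%N = false) 1?(_ : (2 * m == m + n)%N = false) ?mulr0 //; lia.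
Qed.

Lemma quinom_coef0 : P`_0 = 1.
Proof.
rewrite coef_quinom eqxx.
rewrite (_ : (0 == m)%N = false) 1?(_ : (0 == m - n)%N = false); [|lia..].
by rewrite (_ : (0 == 2 * m)%N = false) 1?(_ : (0 == m + n)%N = false) ?mulr0 //; lia.
Qed.

Lemma revp_quinom : revp (2 * m) P = P.
Proof.
apply/polyP=> i; rewrite coef_revp; case: leqP => [le|lt]; last by rewrite nth_default // size_quinom.
rewrite !coef_quinom.
rewrite (_ : (2 * m - i == 0)%N = (i == 2 * m)%N) 1?(_ : (2 * m - i == 2 * m)%N = (i == 0)%N); [|lia..].
rewrite (_ : (2 * m - i == m)%N = (i == m)%N) 1?(_ : (2 * m - i == m + n)%N = (i == m - n)%N); [|lia..].
rewrite (_ : (2 * m - i == m - n)%N = (i == m + n)%N); last lia.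
by ring.
Qed.

(* Ljunggren's device: if [P = q * r] then [W = q * r*] satisfies [W * W* = P * P*];
   comparing constant terms forces [W] to have five coefficients [+-1], and comparing
   the exponents then forces [W = +-P]. *)
Lemma quinom_factor_reciprocal q r : P = q * r -> reciprocal q.
Proof.
move=> Pqr; have P0 : P != 0 by rewrite -size_poly_gt0 size_quinom.
have [q0 r0] : q != 0 /\ r != 0 by apply/andP; rewrite -negb_or -mulf_eq0 -Pqr.
set dq := (size q).-1; set dr := (size r).-1.
have sq : size q = dq.+1 by rewrite /dq prednK // size_poly_gt0.
have sr : size r = dr.+1 by rewrite /dr prednK // size_poly_gt0.
have dqr : (dq + dr = 2 * m)%N.
  by have := size_mul q0 r0; rewrite -Pqr size_quinom sq sr; lia.
set q' := revp dq q; set r' := revp dr r.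
have P' : q' * r' = P by rewrite -revp_quinom -dqr -revpM ?sq ?sr // -Pqr.
have sr' : (size r' <= dr.+1)%N by apply: size_poly.
pose W := q * r'.
have revW : revp (2 * m) W = q' * r by rewrite -dqr revpM ?sq // revpK ?sr.
have WW : W * revp (2 * m) W = P * revp (2 * m) P.
  by rewrite revW revp_quinom -{1}P' Pqr /W; ring.
have sW : (size W <= (2 * m).+1)%N.
  apply: leq_trans (size_polyMleq _ _) _; rewrite sq -dqr addSn /= -addnS leq_add2l.
  exact: sr'.
have coefW0 : W`_0 = q`_0 * r`_dr by rewrite coef0M coef_revp subn0.
have coefWN : W`_(2 * m) = q`_dq * r`_0.
  have := coef_revp (2 * m) W 0; rewrite subn0 /= => <-.
  by rewrite revW coef0M coef_revp subn0.
(* Regrouped, this is the constant coefficient of q r times its leading one, and both are 1. *)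
have W0N : W`_0 * W`_(2 * m) = 1.
  have := quinom_coef0; rewrite {1}Pqr coef0M => E1.
  have := quinom_coef0; rewrite -P' coef0M !coef_revp !subn0 /= => E2.
  by rewrite coefW0 coefWN -[RHS]mulr1 -{1}E1 -E2; ring.
have sumW : \sum_(i < (2 * m).+1) W`_i ^+ 2 = 5.
  rewrite -coef_mul_revp WW coef_mul_revp P5_sumsq; [|lia..].
  by case: he => ->.
have m2 : (0 < 2 * m)%N by lia.
have [s [s1 [s2 [s3 [w1 [w2 [w3 [[ss h1 h2 h3] [w12 w23 DW]]]]]]]]] := eq_P5_of_sumsq _ _ m2 sW W0N sumW.
have sgn (x : int) : x ^+ 2 = 1 -> x = 1 \/ x = -1.
  by move/eqP; rewrite sqrf_eq1 => /orP[]/eqP; [left | right].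
have {}DW : W = s *: P.
  suff H d : (0 < d)%N -> corr5 s1 s2 s3 (2 * m) w1 w2 w3 d =
      corr5 (-1) e (-1) (2 * m) (m - n) m (m + n) d.
    have [[E1 E2 E3] [S1 S2 S3]] :=
      corr5_inj m n e s1 s2 s3 w1 w2 w3 nm w12 w23 he (sgn _ h1) (sgn _ h2) (sgn _ h3) H.
    by rewrite DW E1 E2 E3 S1 S2 S3.
  move=> d0; rewrite -!P5_corr //; try lia.
  by rewrite -[in RHS]/P -WW DW revpZ -scalerAl -scalerAr scalerA -expr2 ss scale1r.
have r's : r' = s *: r.
  by apply: (mulfI q0); rewrite -/W DW Pqr -scalerAr.
have q's : q = s *: q'.
  by apply: (mulIf r0); rewrite -Pqr -P' r's -scalerAl -scalerAr.
split=> //; exists s; first exact: sgn.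
by move=> i le; rewrite {1}q's coefZ coef_revp le.
Qed.
End TrinomFactor.

Lemma GT_factor_reciprocal a b q r : (0 < a)%N -> (0 < b)%N -> a <> b ->
  GT a b = q * r -> reciprocal q.
Proof.
move=> a0 b0 ab; have [s [e [hs he ->]]] := GT_quinom a b ab.
move=> E; apply: (quinom_factor_reciprocal e _ _ he (minn_lt_maxn _ _ a0 b0 ab) q (s *: r)).
by rewrite -scalerAr -E scalerA; case: hs => ->; rewrite ?mulrNN mulr1 scale1r.
Qed.

Lemma size_GT a b : (0 < a)%N -> (0 < b)%N -> a <> b -> size (GT a b) = (2 * maxn a b).+1.
Proof.
move=> a0 b0 ab; have [s [e [hs he ->]]] := GT_quinom a b ab.
rewrite size_scale; first exact: (size_quinom e _ _ he (minn_lt_maxn _ _ a0 b0 ab)).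
by case: hs => ->.
Qed.

Lemma polyZ_unitE (p : {poly int}) :
  (p \is a GRing.unit) = (size p == 1%N) && (lead_coef p \is a GRing.unit).
Proof.
rewrite poly_unitE; case: eqP => //= sp; by rewrite /lead_coef sp.
Qed.

(** Induction on the size plus the modulus of the leading coefficient: a nonunit cofactor raises the
    degree or, if constant, at least doubles the leading coefficient. *)
Lemma irreducibleZ_factorization (p : {poly int}) : p != 0 -> p \isn't a GRing.unit ->
  exists2 s : seq {poly int}, (forall q, q \in s -> irreducibleZ q) & p = \prod_(q <- s) q.
Proof.
pose w (p : {poly int}) := (size p + `|lead_coef p|)%N.
have [k] := ubnP (w p); elim: k p => // k IH p /ltnSE wp p0 pu.
have [irr|nirr] := pselect (irreducibleZ p).
  by exists [:: p] => [q|]; rewrite ?big_seq1 // inE => /eqP->.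
have [q [r [Dp qu ru]]] : exists q, exists r, [/\ p = q * r, q \isn't a GRing.unit & r \isn't a GRing.unit].
  apply: contrapT => H; apply: nirr; split=> // q r Dp.
  have [qu|qu] := boolP (q \is a GRing.unit); first by left.
  have [ru|ru] := boolP (r \is a GRing.unit); first by right.
  by case: H; exists q, r.
have [q0 r0] : q != 0 /\ r != 0 by apply/andP; rewrite -negb_or -mulf_eq0 -Dp.
have wlt (x y : {poly int}) : x != 0 -> y != 0 -> y \isn't a GRing.unit -> (w x < w (x * y)%R)%N.
  move=> x0 y0; rewrite polyZ_unitE /w lead_coefM abszM size_mul //.
  rewrite negb_and unfold_in /= => yu.
  have : (0 < size x)%N by rewrite size_poly_gt0.
  have : (0 < size y)%N by rewrite size_poly_gt0.
  have : (0 < `|lead_coef x|)%N by rewrite absz_gt0 lead_coef_eq0.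
  have : (0 < `|lead_coef y|)%N by rewrite absz_gt0 lead_coef_eq0.
  case/orP: yu => [|yu].
    move: (size x) (size y) `|lead_coef x|%N `|lead_coef y|%N => i j c d j1 d0 c0 j0 i0.
    have : (c <= c * d)%N by rewrite leq_pmulr.
    lia.
  have : (`|lead_coef y| != 1)%N by move: (lead_coef y) yu => z; lia.
  move: (size x) (size y) `|lead_coef x|%N `|lead_coef y|%N => i j c d d1 d0 c0 j0 i0.
  have : (2 * c <= c * d)%N by rewrite mulnC leq_mul2l; apply/orP; right; lia.
  lia.
have [|s irr_s Dq] := IH q _ q0 qu; first by apply: leq_trans wp; rewrite Dp wlt.
have [|t irr_t Dr] := IH r _ r0 ru; first by apply: leq_trans wp; rewrite Dp mulrC wlt.
exists (s ++ t); last by rewrite big_cat /= -Dq -Dr.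
by move=> x; rewrite mem_cat => /orP[/irr_s|/irr_t].
Qed.

Lemma part_b a b : (0 < a)%N -> (0 < b)%N -> a <> b ->
     exists s : seq {poly int},
       (forall q, q \in s -> irreducibleZ q /\ reciprocal q) /\
       GT a b = \prod_(q <- s) q.
Proof.
move=> a0 b0 ab.
have [||s irr Ds] := irreducibleZ_factorization (GT a b); first exact: GT_neq0.
  by rewrite polyZ_unitE; rewrite size_GT //; case: eqP => //; lia.
exists s; split=> // q qs; split; first exact: irr.
apply: (GT_factor_reciprocal a b _ (\prod_(x <- rem q s) x)) => //.
by rewrite Ds (big_rem _ qs).
Qed.

Set Implicit Arguments.
Unset Strict Implicit.
Unset Printing Implicit Defensive.
Import numFieldNormedType.Exports.
Local Open Scope classical_set_scope.

(** * Jensen's formula on the unit circle *)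

Section CircleDistance.
Variable R : realType.
Let mu := @lebesgue_measure R.
Implicit Types (a b t : R).

(* [dist2 a b t] is |e^(2 i pi t) - (a + i b)|^2. *)
Definition dist2 a b t : R := (cos (2 * pi * t) - a) ^+ 2 + (sin (2 * pi * t) - b) ^+ 2.

Lemma dist2_ge0 a b t : 0 <= dist2 a b t.
Proof. by rewrite addr_ge0 // sqr_ge0. Qed.

Definition dotc a b t : R := cos (2 * pi * t) * a + sin (2 * pi * t) * b.

Lemma dist2E a b t : dist2 a b t = 1 + (a ^+ 2 + b ^+ 2) - 2 * dotc a b t.
Proof. by rewrite -[X in X + (_ + _)](cos2Dsin2 (2 * pi * t)) /dist2 /dotc; ring. Qed.

Lemma dotc_sqr_le a b t : dotc a b t ^+ 2 <= a ^+ 2 + b ^+ 2.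
Proof.
rewrite -[leRHS]mul1r -(cos2Dsin2 (2 * pi * t)) -subr_ge0 /dotc.
set c := cos _; set s := sin _.
have -> : (c ^+ 2 + s ^+ 2) * (a ^+ 2 + b ^+ 2) - (c * a + s * b) ^+ 2 = (c * b - s * a) ^+ 2 by ring.
exact: sqr_ge0.
Qed.

(** For c = a + i b, |w - c| >= 1 - |c| = (1 - |c|^2) / (1 + |c|), and 1 + |c| <= 2; this form
    avoids the square root in |c|. *)
Lemma dist2_ge a b t : a ^+ 2 + b ^+ 2 <= 1 -> (1 - (a ^+ 2 + b ^+ 2)) ^+ 2 / 4 <= dist2 a b t.
Proof.
move=> r1; have := dotc_sqr_le a b t; rewrite dist2E.
have r0 : 0 <= a ^+ 2 + b ^+ 2 by rewrite addr_ge0 ?sqr_ge0.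
move: (a ^+ 2 + b ^+ 2) (dotc a b t) r0 r1 => r x r0 r1 xr.
have [x1 x2] : x <= 1 /\ -1 <= x by split; nra.
have y0 : 0 <= 1 + r - 2 * x by nra.
have z4 : 0 <= 4 - (1 + r + 2 * x) by lra.
have := mulr_ge0 y0 z4; nra.
Qed.

Lemma dist2_le4 a b t : a ^+ 2 + b ^+ 2 <= 1 -> dist2 a b t <= 4.
Proof.
move=> r1; have := dotc_sqr_le a b t; rewrite dist2E.
by move: (a ^+ 2 + b ^+ 2) (dotc a b t) r1 => r x r1 xr; nra.
Qed.

(** The parameters t / 2 and (t + 1) / 2 give the two square roots w and - w of e^(2 i pi t), and (w
    - c) (- w - c) = - (w^2 - c^2). *)
Lemma dist2_half a b t :
  dist2 a b (t / 2) * dist2 a b ((t + 1) / 2) = dist2 (a ^+ 2 - b ^+ 2) (2 * a * b) t.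
Proof.
have E : 2 * pi * ((t + 1) / 2) = 2 * pi * (t / 2) + pi :> R by field.
rewrite /dist2 E sinDpi cosDpi.
have -> : 2 * pi * t = 2 * pi * (t / 2) + 2 * pi * (t / 2) :> R by field.
by rewrite cosD sinD; ring.
Qed.

Lemma continuous_mul2pi : continuous (fun t : R => 2 * pi * t).
Proof. by move=> t; apply: cvgM; [exact: cvg_cst|exact: cvg_id]. Qed.

Lemma continuous_dist2 a b : continuous (dist2 a b).
Proof.
have sq (f : R -> R) c : continuous f -> continuous (fun t => (f t - c) ^+ 2).
  move=> cf t; apply: (@continuous_comp _ _ _ (fun x => f x - c) (fun x : R => x ^+ 2)).
    by apply: cvgB; [exact: cf | exact: cvg_cst].
  exact: exprn_continuous.
move=> t; apply: cvgD; apply: sq => {}t.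
  apply: (@continuous_comp _ _ _ (fun x => 2 * pi * x) (@cos R)).
    exact: continuous_mul2pi.
  exact: continuous_cos.
apply: (@continuous_comp _ _ _ (fun x => 2 * pi * x) (@sin R)).
  exact: continuous_mul2pi.
exact: continuous_sin.
Qed.

Lemma measurable_dist2 a b (D : set R) : measurable_fun D (dist2 a b).
Proof.
apply: measurable_funTS; exact: (continuous_measurable_fun (@continuous_dist2 a b)).
Qed.

Lemma measurable_ln_dist2 a b (D : set R) : measurable_fun D (fun t => ln (dist2 a b t)).
Proof.
by apply: measurableT_comp; [exact: measurable_ln | exact: measurable_dist2].
Qed.

(** The cosine is injective on each half of the period, so it takes the value [a] at most at u and 1
    - u. *)
Lemma dist2_eq0_negligible a b : mu.-negligible [set t | 0 <= t <= 1 /\ dist2 a b t = 0].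
Proof.
pose u := acos a / (2 * pi).
apply: (@negligibleS _ _ _ mu [set u; 1 - u]); last first.
  by apply: negligibleU; apply/negligibleP => //; exact: lebesgue_measure_set1.
move=> t /= [/andP[t0 t1] /eqP].
rewrite /dist2 paddr_eq0 ?sqr_ge0 // !sqrf_eq0 !subr_eq0 => /andP[/eqP ca _].
have pi2 : 2 * pi != 0 :> R by rewrite mulf_neq0 // gt_eqF // pi_gt0.
have pi0 := pi_gt0 R.
have half (x : R) : 0 <= x -> x <= 1 / 2 -> 0 <= 2 * pi * x <= pi.
  move=> x0 x1; have -> : 2 * pi * x = pi * (2 * x) by ring.
  apply/andP; split; first by apply: mulr_ge0; [exact: ltW | lra].
  by rewrite ler_piMr ?(ltW pi0) //; lra.
have [th|th] := leP t (1 / 2).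
  left; rewrite /u -ca cosK ?in_itv /=; first by rewrite mulrAC mulfV // mul1r.
  by apply: half; lra.
right; rewrite /u -ca (_ : cos (2 * pi * t) = cos (2 * pi * (1 - t))).
  rewrite cosK ?in_itv /=; first by rewrite mulrAC mulfV // mul1r; ring.
  by apply: half; lra.
rewrite -cosN -(cosD2pi (- _)); congr cos.
by rewrite -mulr_natr; ring.
Qed.

End CircleDistance.

Section AffineSubstitution.
Variable R : realType.
Let mu := @lebesgue_measure R.
Implicit Types (a b t : R).

Lemma integrable_continuous_itv (G : R -> R) (a b : R) : continuous G ->
  mu.-integrable `[a, b] (EFin \o G).
Proof.
move=> cG; apply: continuous_compact_integrable; first exact: segment_compact.
exact: continuous_subspaceT.
Qed.

Lemma Rintegral_affine (G : R -> R) (c d a b : R) : continuous G -> 0 < c -> a <= b ->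
  Rintegral mu `[c * a + d, c * b + d] G = c * Rintegral mu `[a, b] (fun t => G (c * t + d)).
Proof.
move=> cG c0 ab.
pose F t := c * t + d.
have cF : continuous F.
  by move=> t; apply: cvgD; [apply: cvgM; [exact: cvg_cst | exact: cvg_id] | exact: cvg_cst].
have dF (t : R) : is_derive t 1 F c.
  by rewrite /F; apply: is_derive_eq; rewrite /GRing.scale /=; ring.
have F' : F^`() = cst c by apply/funext => t; rewrite derive1E; apply: derive_val.
rewrite {1}/Rintegral (@integration_by_substitution_increasing R F G a b) //.
- rewrite -RintegralZl //; last first.
    apply: (@integrable_continuous_itv (fun t => G (F t))) => t.
    by apply: continuous_comp; [exact: cF | exact: cG].
  by congr fine; apply: eq_integral => t _; rewrite F' /= mulrC.
- by move=> x y _ _ xy; rewrite ltrD2r ltr_pM2l.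
- by move=> x _; rewrite F'; exact: cvg_cst.
- by rewrite F'; exact: is_cvg_cst.
- by rewrite F'; exact: is_cvg_cst.
- split => /=.
  + by move=> x _; exact: ex_derive.
  + by apply: cvg_at_right_filter; exact: cF.
  + by apply: cvg_at_left_filter; exact: cF.
- exact: continuous_subspaceT.
Qed.

Lemma Rintegral_halves (G : R -> R) : continuous G ->
  Rintegral mu `[0, 1] G =
  (Rintegral mu `[0, 1] (fun t => G (t / 2)) + Rintegral mu `[0, 1] (fun t => G ((t + 1) / 2))) / 2.
Proof.
move=> cG.
have h2 : (0 : R) < 2^-1 by rewrite invr_gt0.
have E1 := @Rintegral_affine G 2^-1 0 0 1 cG h2 ler01.
have E2 := @Rintegral_affine G 2^-1 2^-1 0 1 cG h2 ler01.
have eqh : 2^-1 + 2^-1 = 1 :> R by lra.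
rewrite mulr0 mulr1 !add0r addr0 in E1.
rewrite mulr0 mulr1 add0r eqh in E2.
have I01 := @integrable_continuous_itv G 0 1 cG.
have := @Rintegral_itvB R G (BLeft 0) (BRight 1) 2^-1 I01.
rewrite !bnd_simp /= Rintegral_itv_obnd_cbnd; last first.
  apply: integrableS I01 => // x /=; rewrite !in_itv /= => /andP[x0 x1].
  by apply/andP; split; lra.
move=> H; have {}H := H _ _.
have -> : Rintegral mu `[0, 1] G = Rintegral mu `[0, 2^-1] G + Rintegral mu `[2^-1, 1] G.
  rewrite -H; [by rewrite addrC subrK | lra | lra].
rewrite E1 E2 -mulrDr mulrC; congr ((_ + _) / 2); apply: eq_Rintegral => t _; congr G; lra.
Qed.

End AffineSubstitution.

Section LogIntegralInside.
Variable R : realType.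
Let mu := @lebesgue_measure R.
Implicit Types (a b t : R).

Definition log_integral a b : R := Rintegral mu `[0, 1] (fun t => ln (dist2 a b t)).
Local Notation L := log_integral.

Lemma Rintegral01_cst (c : R) : Rintegral mu `[0, 1] (fun=> c) = c.
Proof. by rewrite Rintegral_cst //= lebesgue_measure_itv /= lte_fin ltr01 oppr0 adde0 mulr1. Qed.

Lemma integrable_cst01 (c : R) : mu.-integrable `[0, 1] (EFin \o fun=> c).
Proof. by apply: integrable_continuous_itv => t; exact: cvg_cst. Qed.

Lemma dist2_gt0 a b t : a ^+ 2 + b ^+ 2 < 1 -> 0 < dist2 a b t.
Proof.
move=> r1; apply: lt_le_trans (dist2_ge _ (ltW r1)).
by rewrite divr_gt0 // exprn_gt0 // subr_gt0.
Qed.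

Lemma continuous_ln_dist2 a b : a ^+ 2 + b ^+ 2 < 1 -> continuous (fun t => ln (dist2 a b t)).
Proof.
move=> r1 t; apply: continuous_comp; first exact: continuous_dist2.
by apply: continuous_ln; exact: dist2_gt0.
Qed.

Lemma integrable_ln_dist2_lt1 a b : a ^+ 2 + b ^+ 2 < 1 ->
  mu.-integrable `[0, 1] (EFin \o fun t => ln (dist2 a b t)).
Proof. by move=> r1; apply: integrable_continuous_itv; exact: continuous_ln_dist2. Qed.

Lemma sqr_norm2 a b : (a ^+ 2 - b ^+ 2) ^+ 2 + (2 * a * b) ^+ 2 = (a ^+ 2 + b ^+ 2) ^+ 2.
Proof. by ring. Qed.

Lemma sqr_le_id (x : R) : 0 <= x -> x <= 1 -> x ^+ 2 <= x.
Proof. by move=> x0 x1; nra. Qed.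

(* Averaging over [t] and [t + 1/2] squares the centre [a + i b]. *)
Lemma log_integral_double a b : a ^+ 2 + b ^+ 2 < 1 ->
  L a b = L (a ^+ 2 - b ^+ 2) (2 * a * b) / 2.
Proof.
move=> r1; have cL := continuous_ln_dist2 r1.
have caff (d : R) : continuous (fun t => (t + d) / 2).
  by move=> t; apply: cvgM; [apply: cvgD; [exact: cvg_id | exact: cvg_cst] | exact: cvg_cst].
have I (d : R) : mu.-integrable `[0, 1] (EFin \o fun t => ln (dist2 a b ((t + d) / 2))).
  apply: (@integrable_continuous_itv _ (fun t => ln (dist2 a b ((t + d) / 2)))) => t.
  by apply: (@continuous_comp _ _ _ (fun t => (t + d) / 2) (fun t => ln (dist2 a b t)));
    [exact: caff | exact: cL].
have I0 : mu.-integrable `[0, 1] (EFin \o fun t => ln (dist2 a b (t / 2))).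
  have -> : (fun t => ln (dist2 a b (t / 2))) = (fun t => ln (dist2 a b ((t + 0) / 2))).
    by apply/funext => t; rewrite addr0.
  exact: I.
rewrite /L (Rintegral_halves cL) -RintegralD //.
congr (_ / 2); apply: eq_Rintegral => t _.
by rewrite -lnM ?dist2_half // posrE dist2_gt0.
Qed.

Lemma log_integral_bound (r a b : R) : r < 1 -> a ^+ 2 + b ^+ 2 <= r ->
  `|L a b| <= ln 4 + `|ln ((1 - r) ^+ 2 / 4)|.
Proof.
move=> r1 abr; have ab1 := le_lt_trans abr r1.
have r0 : 0 <= a ^+ 2 + b ^+ 2 by rewrite addr_ge0 ?sqr_ge0.
have ln4 : 0 <= ln 4 :> R by apply: ln_ge0; rewrite ler1n.
have c0 : 0 < (1 - r) ^+ 2 / 4 by rewrite divr_gt0 // exprn_gt0 // subr_gt0.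
have lo t : - (ln 4 + `|ln ((1 - r) ^+ 2 / 4)|) <= ln (dist2 a b t).
  apply: (@le_trans _ _ (ln ((1 - r) ^+ 2 / 4))).
    have := ler_norm (- ln ((1 - r) ^+ 2 / 4)); rewrite normrN; lra.
  rewrite ler_ln ?posrE ?dist2_gt0 //; apply: le_trans (dist2_ge _ (ltW ab1)).
  by rewrite ler_pM2r // ler_sqr ?nnegrE; lra.
have up t : ln (dist2 a b t) <= ln 4 + `|ln ((1 - r) ^+ 2 / 4)|.
  apply: (@le_trans _ _ (ln 4)); last by rewrite lerDl.
  by rewrite ler_ln ?posrE ?dist2_gt0 ?dist2_le4 // ltW.
have I := integrable_ln_dist2_lt1 ab1.
rewrite ler_norml; apply/andP; split.
  by rewrite -[leLHS]Rintegral01_cst; apply: le_Rintegral => //; exact: integrable_cst01.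
by rewrite -[leRHS]Rintegral01_cst; apply: le_Rintegral => //; exact: integrable_cst01.
Qed.

(** Squaring the centre keeps it in the same disc, on which L is bounded by M, and each doubling
    halves L. Hence |L| <= M / 2^k for all k. *)
Lemma log_integral_lt1 a b : a ^+ 2 + b ^+ 2 < 1 -> L a b = 0.
Proof.
move=> r1; set r := a ^+ 2 + b ^+ 2 in r1.
set M := ln 4 + `|ln ((1 - r) ^+ 2 / 4)|.
have bd k : forall x y, x ^+ 2 + y ^+ 2 <= r -> `|L x y| <= M / 2 ^+ k.
  elim: k => [|k IH] x y xy; first by rewrite divr1; exact: log_integral_bound.
  rewrite log_integral_double; last exact: le_lt_trans r1.
  rewrite normrM (ger0_norm (_ : 0 <= 2^-1)) // (exprSr 2 k) invfM mulrA ler_pM2r //.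
  apply: IH; rewrite sqr_norm2; apply: (le_trans _ xy); apply: sqr_le_id.
    by rewrite addr_ge0 ?sqr_ge0.
  exact: le_trans xy (ltW r1).
apply/eqP; rewrite -normr_eq0 eq_le normr_ge0 andbT leNgt; apply/negP => L0.
have M0 : 0 <= M.
  by apply: le_trans (normr_ge0 (L a b)) _; have := bd 0%N a b (lexx _); rewrite expr0 divr1.
have x0 : 0 <= M / `|L a b| by rewrite divr_ge0.
have := archi_boundP x0; set k := Num.bound _ => kP.
have := bd k a b (lexx _); apply/negP; rewrite -ltNge ltr_pdivrMr ?exprn_gt0 //.
rewrite mulrC -ltr_pdivrMr //; apply: lt_le_trans kP _.
by rewrite -natrX ler_nat ltnW // ltn_expl.
Qed.

(** On the unit circle |w - c| = |c| |w - c / |c|^2|: inversion moves a centre from outside the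
    circle to inside. *)
Lemma dist2_inversion a b t : let r := a ^+ 2 + b ^+ 2 in r != 0 ->
  dist2 a b t = r * dist2 (a / r) (b / r) t.
Proof. by move=> r r0; rewrite !dist2E /dotc /r; field. Qed.

End LogIntegralInside.

Section JensenFormula.
Variable R : realType.
Let mu := @lebesgue_measure R.
Implicit Types (a b t : R).
Local Notation L := log_integral.

(* For a centre [c] on the unit circle and [w] on it, |w - r c|^2 / r decreases to |w - c|^2
   as [r] increases to 1, so the singular integral follows by monotone convergence. *)
Definition radius (n : nat) : R := 1 - harmonic n / 2.

Lemma radius_itv n : 1 / 2 <= radius n < 1.
Proof.
have h0 : 0 < (n.+1%:R : R)^-1 by rewrite invr_gt0.
have h1 : (n.+1%:R : R)^-1 <= 1 by rewrite invf_le1 // ler1n.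
rewrite /radius (_ : harmonic n = (n.+1%:R)^-1) //.
by move: (n.+1%:R^-1 : R) h0 h1 => x h0 h1; apply/andP; split; lra.
Qed.

Lemma radius_homo n m : (n <= m)%N -> radius n <= radius m.
Proof.
move=> nm; rewrite /radius (_ : harmonic n = (n.+1%:R)^-1) // (_ : harmonic m = (m.+1%:R)^-1) //.
have : (m.+1%:R : R)^-1 <= (n.+1%:R)^-1 by rewrite lef_pV2 ?posrE // ler_nat.
by move: (n.+1%:R^-1 : R) (m.+1%:R^-1 : R) => x y; lra.
Qed.

Lemma cvg_radius : radius n @[n --> \oo] --> (1 : R).
Proof.
rewrite -[X in _ --> X]subr0; apply: cvgB; first exact: cvg_cst.
rewrite -[X in _ --> X](mul0r (2^-1)); apply: cvgM; last exact: cvg_cst.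
exact: cvg_harmonic.
Qed.

Definition dist2s a b n t : R := dist2 (radius n * a) (radius n * b) t / radius n.

Lemma dist2sE a b n t : a ^+ 2 + b ^+ 2 = 1 ->
  dist2s a b n t = radius n + (radius n)^-1 - 2 * dotc a b t.
Proof.
move=> ab1; have /andP[r0 r1] := radius_itv n.
have rn0 : radius n != 0 by rewrite gt_eqF //; lra.
rewrite /dist2s dist2E !exprMn -mulrDr ab1 mulr1.
have -> : dotc (radius n * a) (radius n * b) t = radius n * dotc a b t by rewrite /dotc; ring.
by field.
Qed.

Lemma dotc_itv a b t : a ^+ 2 + b ^+ 2 = 1 -> -1 <= dotc a b t <= 1.
Proof. by move=> ab1; have := dotc_sqr_le a b t; rewrite ab1 => h; apply/andP; split; nra. Qed.

Lemma norm_radius_lt1 a b n : a ^+ 2 + b ^+ 2 = 1 ->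
  (radius n * a) ^+ 2 + (radius n * b) ^+ 2 < 1.
Proof.
by move=> ab1; have /andP[r0 r1] := radius_itv n; rewrite !exprMn -mulrDr ab1 mulr1; nra.
Qed.

Lemma dist2s_gt0 a b n t : a ^+ 2 + b ^+ 2 = 1 -> 0 < dist2s a b n t.
Proof.
move=> ab1; have /andP[r0 r1] := radius_itv n.
by rewrite divr_gt0 ?dist2_gt0 ?norm_radius_lt1 //; lra.
Qed.

Lemma dist2s_homo a b n m t : a ^+ 2 + b ^+ 2 = 1 -> (n <= m)%N ->
  dist2s a b m t <= dist2s a b n t.
Proof.
move=> ab1 nm; rewrite !dist2sE // lerD2r.
have /andP[r0 r1] := radius_itv n; have /andP[s0 s1] := radius_itv m.
have := radius_homo nm; move: (radius n) (radius m) r0 r1 s0 s1 => r s r0 r1 s0 s1 rs.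
have [rp sp] : 0 < r /\ 0 < s by split; lra.
rewrite -subr_ge0 (_ : _ - _ = (s - r) * (1 - r * s) / (r * s)); last first.
  by field; rewrite !gt_eqF.
apply: divr_ge0; last by rewrite mulr_ge0 // ltW.
by apply: mulr_ge0; [lra | rewrite subr_ge0 mulr_ile1 // ltW].
Qed.

Lemma dist2s_le5 a b n t : a ^+ 2 + b ^+ 2 = 1 -> dist2s a b n t <= 5.
Proof.
move=> ab1; rewrite dist2sE //; have /andP[d0 d1] := dotc_itv t ab1.
have /andP[r0 r1] := radius_itv n.
have : (radius n)^-1 <= 2.
  by rewrite -[leRHS]invrK lef_pV2 ?posrE //; lra.
lra.
Qed.

Lemma cvg_ln_dist2s a b t : a ^+ 2 + b ^+ 2 = 1 -> dist2 a b t != 0 ->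
  ln (dist2s a b n t) @[n --> \oo] --> ln (dist2 a b t).
Proof.
move=> ab1 d0; have d1 : 0 < dist2 a b t by rewrite lt_neqAle eq_sym d0 dist2_ge0.
apply: (@continuous_cvg _ _ _ _ _ _ (@ln R)); first exact: continuous_ln.
under eq_fun do rewrite dist2sE //.
rewrite dist2E ab1 -{1}[1]invr1.
rewrite [X in X - _]addrC.
apply: cvgB; last exact: cvg_cst.
apply: cvgD; first exact: cvg_radius.
by apply: cvgV; [exact: oner_neq0 | exact: cvg_radius].
Qed.

(** Nonnegative, since r + 1/r + 2 <= 5 for r between 1/2 and 1, and increasing in n: the form
    required by monotone convergence. *)
Definition gap a b n t : R := ln 5 - ln (dist2s a b n t).

Lemma integrable_ln_dist2s a b n : a ^+ 2 + b ^+ 2 = 1 ->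
  mu.-integrable `[0, 1] (EFin \o fun t => ln (dist2s a b n t)) /\
  Rintegral mu `[0, 1] (fun t => ln (dist2s a b n t)) = - ln (radius n).
Proof.
move=> ab1; have r1 := norm_radius_lt1 n ab1; have /andP[s0 s1] := radius_itv n.
have s0' : 0 < radius n by lra.
have -> : (fun t => ln (dist2s a b n t)) = 
   (fun t => ln (dist2 (radius n * a) (radius n * b) t) - ln (radius n)).
  by apply/funext => t; rewrite ln_div // ?posrE // dist2_gt0.
have I1 := integrable_ln_dist2_lt1 r1; have I2 := integrable_cst01 (ln (radius n)).
split; first by have := integrableB _ I1 I2; apply.
by rewrite RintegralB // -/(log_integral _ _) log_integral_lt1 // Rintegral01_cst sub0r.
Qed.

Lemma jensen_eq1 a b : a ^+ 2 + b ^+ 2 = 1 ->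
  mu.-integrable `[0, 1] (EFin \o fun t => ln (dist2 a b t)) /\ L a b = 0.
Proof.
move=> ab1.
have ln5 : 0 < ln 5 :> R by apply: ln_gt0; rewrite ltr1n.
have mD : measurable (`[0%R, 1%R] : set R) by exact: measurable_itv.
have gap_ge0 n t : 0 <= gap a b n t.
  by rewrite subr_ge0 ler_ln ?posrE ?dist2s_gt0 // dist2s_le5.
have mgap n : measurable_fun (`[0%R, 1%R] : set R) (EFin \o gap a b n).
  apply/measurable_EFinP; apply: measurable_funB; first exact: measurable_cst.
  by have [/integrableP[/measurable_EFinP ? _] _] := integrable_ln_dist2s n ab1.
have hgap t : nondecreasing_seq ((fun n => (gap a b n t)%:E) : (\bar R)^nat).
  move=> n m nm; rewrite lee_fin lerD2l lerN2 ler_ln ?posrE ?dist2s_gt0 //.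
  exact: dist2s_homo.
pose f t := (ln 5 - ln (dist2 a b t))%:E.
have mf : measurable_fun (`[0%R, 1%R] : set R) f.
  apply/measurable_EFinP; apply: measurable_funB; first exact: measurable_cst.
  exact: measurable_ln_dist2.
have f0 t : (0 <= f t)%E.
  rewrite lee_fin subr_ge0; have [->|d0] := eqVneq (dist2 a b t) 0; first by rewrite ln0 // ltW.
  have d1 : 0 < dist2 a b t by rewrite lt_neqAle eq_sym d0 dist2_ge0.
  rewrite ler_ln ?posrE //; apply: le_trans (dist2_le4 _ _) _; first by rewrite ab1.
  by rewrite ler_nat.
have int_gap n : (\int[mu]_(t in `[0%R, 1%R]) (gap a b n t)%:E = (ln 5 + ln (radius n))%:E)%E.
  have [I E] := integrable_ln_dist2s n ab1.
  have I5 := integrable_cst01 (ln 5 : R).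
  rewrite -[LHS]fineK; last by apply: integrable_fin_num => //; exact: (integrableB _ I5 I).
  congr EFin; rewrite -/(Rintegral _ _ _) RintegralB // E opprK Rintegral01_cst //.
have int_f : (\int[mu]_(t in `[0%R, 1%R]) f t = (ln 5)%:E)%E.
  have cvg_gap t : dist2 a b t != 0 -> limn (fun n => (gap a b n t)%:E) = f t.
    move=> d0; apply/cvg_lim => //; apply: cvg_EFin; first exact: nearW.
    by apply: cvgB; [exact: cvg_cst | exact: cvg_ln_dist2s].
  (* The two integrands differ only at the zeros of [dist2], where the limit is infinite but
     [ln 0 = 0] keeps [f] finite. *)
  transitivity (\int[mu]_(t in `[0%R, 1%R]) limn (fun n => (gap a b n t)%:E))%E.
    apply: ge0_ae_eq_integral => //.
    - apply: emeasurable_fun_cvg mgap _ => t _; exact: (ereal_nondecreasing_is_cvgn (hgap t)).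
    - move=> t _; apply: lime_ge; first exact: (ereal_nondecreasing_is_cvgn (hgap t)).
      by apply: nearW => n; rewrite lee_fin.
    - apply: (@negligibleS _ _ _ mu _ _ _ (dist2_eq0_negligible a b)) => t /= /not_implyP[].
      rewrite in_itv /= => t01 H; split=> //; apply/eqP/negPn/negP => d0; apply: H.
      by rewrite cvg_gap.
  rewrite monotone_convergence //; last by move=> n t _; rewrite lee_fin.
  rewrite (_ : (fun n => _) = (fun n => (ln 5 + ln (radius n))%:E)); last first.
    by apply/funext => n; exact: int_gap.
  apply/cvg_lim => //; apply: cvg_EFin; first exact: nearW.
  rewrite -[X in _ --> X]addr0 -(ln1 R); apply: cvgD; first exact: cvg_cst.
  by apply: (@continuous_cvg _ _ _ _ _ _ (@ln R)); [exact: continuous_ln | exact: cvg_radius].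
have I : mu.-integrable `[0, 1] f.
  apply/integrableP; split=> //; under eq_integral do rewrite gee0_abs //.
  by rewrite int_f ltry.
have I5 := integrable_cst01 (ln 5 : R).
have Dln : (fun t => ln (dist2 a b t)) = (fun t => ln 5 - (ln 5 - ln (dist2 a b t))).
  by apply/funext => t; rewrite opprB addrC subrK.
split; first by rewrite Dln; exact: (integrableB _ I5 I).
rewrite /L Dln RintegralB // Rintegral01_cst.
by rewrite /Rintegral int_f subrr.
Qed.

Lemma jensen_gt1 a b : let r := a ^+ 2 + b ^+ 2 in 1 < r ->
  mu.-integrable `[0, 1] (EFin \o fun t => ln (dist2 a b t)) /\ L a b = ln r.
Proof.
move=> r r1; have r0 : 0 < r by lra.
have b1 : (a / r) ^+ 2 + (b / r) ^+ 2 < 1.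
  rewrite !exprMn -mulrDl -/r exprVn expr2 invfM mulrA divff ?gt_eqF // mul1r.
  by rewrite invf_lt1.
have Dln : (fun t => ln (dist2 a b t)) = (fun t => ln r + ln (dist2 (a / r) (b / r) t)).
  apply/funext => t; rewrite dist2_inversion ?gt_eqF // -/r lnM // ?posrE //.
  exact: dist2_gt0.
have I1 := integrable_ln_dist2_lt1 b1; have I2 := integrable_cst01 (ln r).
split; first by rewrite Dln; have := integrableD _ I2 I1; apply.
by rewrite /L Dln RintegralD // -/(log_integral _ _) log_integral_lt1 // Rintegral01_cst addr0.
Qed.

Lemma jensen a b : mu.-integrable `[0, 1] (EFin \o fun t => ln (dist2 a b t)) /\
  L a b = ln (Num.max 1 (a ^+ 2 + b ^+ 2)).
Proof.
have [lt|gt|eq] := ltgtP (a ^+ 2 + b ^+ 2) 1.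
- by rewrite ln1; split; [exact: integrable_ln_dist2_lt1 | exact: log_integral_lt1].
- exact: jensen_gt1.
- by rewrite eq ln1; exact: jensen_eq1.
Qed.

End JensenFormula.

(** * Mahler measures *)

Section LogIntegrable.
Variable R : realType.
Let mu := @lebesgue_measure R.
Let D : set R := `[0%R, 1%R].

Let mD : measurable D. Proof. exact: measurable_itv. Qed.

Lemma integrable_ae_eq (f g : R -> \bar R) : measurable_fun D f ->
  ae_eq mu D f g -> mu.-integrable D g -> mu.-integrable D f.
Proof.
move=> mf fg /integrableP[mg ig]; apply/integrableP; split=> //.
rewrite (@ge0_ae_eq_integral _ _ _ mu D _ (abse \o g)) //.
- exact: measurableT_comp.
- exact: measurableT_comp.
- by move=> x _; exact: abse_ge0.
- exact: ae_eq_abse fg.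
Qed.

(* Since [ln 0 = 0], [ln (x * y) = ln x + ln y] fails at the zeros: they have to be
   negligible for the additivity below. *)
Record log_integrable (q : R -> R) (v : R) : Prop := LogIntegrable {
  li_measurable : measurable_fun D q;
  li_ge0 : forall t, 0 <= q t;
  li_negl : mu.-negligible [set t | 0 <= t <= 1 /\ q t = 0];
  li_integrable : mu.-integrable D (EFin \o fun t => ln (q t));
  li_integral : Rintegral mu D (fun t => ln (q t)) = v }.

Lemma log_integrable_mul q1 q2 v1 v2 : log_integrable q1 v1 -> log_integrable q2 v2 ->
  log_integrable (fun t => q1 t * q2 t) (v1 + v2).
Proof.
move=> [m1 p1 n1 i1 e1] [m2 p2 n2 i2 e2].
have m12 : measurable_fun D (fun t => q1 t * q2 t) by exact: measurable_funM.
have mln (q : R -> R) : measurable_fun D q -> measurable_fun D (EFin \o fun t => ln (q t)).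
  by move=> mq; apply/measurable_EFinP; apply: measurableT_comp => //; exact: measurable_ln.
have n12 : mu.-negligible [set t | 0 <= t <= 1 /\ q1 t * q2 t = 0].
  apply: negligibleS (negligibleU n1 n2) => t /= [t01 /eqP].
  by rewrite mulf_eq0 => /orP[]/eqP q0; [left | right].
have ae : ae_eq mu D (EFin \o fun t => ln (q1 t * q2 t)) (EFin \o fun t => ln (q1 t) + ln (q2 t)).
  apply: negligibleS n12 => t /= /not_implyP[]; rewrite /D /= in_itv /= => t01 H.
  split=> //; apply: contrapT => q0; apply: H.
  move/eqP: q0; rewrite mulf_eq0 negb_or => /andP[q10 q20].
  by rewrite lnM // posrE lt_neqAle eq_sym ?q10 ?q20 ?p1 ?p2.
have i12 : mu.-integrable D (EFin \o fun t => ln (q1 t) + ln (q2 t)).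
  by have := integrableD _ i1 i2; apply; exact: measurable_itv.
split=> //; [by move=> t; rewrite mulr_ge0 | exact: (integrable_ae_eq (mln _ m12) ae i12) |].
rewrite -e1 -e2 -RintegralD //; congr fine; apply: ae_eq_integral => //; first exact: mln.
by case/integrableP: i12.
Qed.

Lemma log_integrable_cst (c : R) : 0 < c -> log_integrable (fun=> c) (ln c).
Proof.
move=> c0; split=> //.
- by move=> _; exact: ltW.
- apply: negligibleS (@negligible_set0 _ _ _ mu) => t /= [_ /eqP].
  by rewrite gt_eqF.
- exact: integrable_cst01.
- exact: Rintegral01_cst.
Qed.

Lemma log_integrable_dist2 a b :
  log_integrable (dist2 a b) (ln (Num.max 1 (a ^+ 2 + b ^+ 2))).
Proof.
have [i e] := jensen a b; split=> //.
- exact: measurable_dist2.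
- exact: dist2_ge0.
- exact: dist2_eq0_negligible.
Qed.

Lemma log_integrable_prod (I : Type) (r : seq I) (q : I -> R -> R) (v : I -> R) :
  (forall i, log_integrable (q i) (v i)) ->
  log_integrable (fun t => \prod_(i <- r) q i t) (\sum_(i <- r) v i).
Proof.
move=> H; elim: r => [|i r IH].
  rewrite big_nil (_ : (fun t => _) = fun=> 1); last by apply/funext => t; rewrite big_nil.
  by rewrite -(ln1 R); exact: log_integrable_cst.
rewrite big_cons (_ : (fun t => _) = fun t => q i t * \prod_(j <- r) q j t).
  exact: log_integrable_mul.
by apply/funext => t; rewrite big_cons.
Qed.

End LogIntegrable.

Section ComplexNorm.
Variable R : realType.
Local Open Scope complex_scope.
Implicit Types z w : R[i].

Definition nsq z : R := complex.Re z ^+ 2 + complex.Im z ^+ 2.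

Lemma nsqM z w : nsq (z * w) = nsq z * nsq w.
Proof. by case: z w => [a b] [c d]; rewrite /nsq /=; ring. Qed.

Lemma nsq_ge0 z : 0 <= nsq z.
Proof. by rewrite addr_ge0 ?sqr_ge0. Qed.

Lemma nsq1 : nsq 1 = 1.
Proof. by rewrite /nsq /= expr1n expr0n addr0. Qed.

Lemma nsqX z n : nsq (z ^+ n) = nsq z ^+ n.
Proof. by elim: n => [|n IH]; rewrite ?expr0 ?nsq1 // !exprS nsqM IH. Qed.

Lemma nsqN z : nsq (- z) = nsq z.
Proof. by case: z => a b; rewrite /nsq /= !sqrrN. Qed.

Lemma nsq_prod (I : Type) (r : seq I) (F : I -> R[i]) :
  nsq (\prod_(i <- r) F i) = \prod_(i <- r) nsq (F i).
Proof. by elim/big_rec2: _ => [|i x y _ <-]; rewrite ?nsq1 ?nsqM. Qed.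

Lemma nsq_eq0 z : (nsq z == 0) = (z == 0).
Proof. by case: z => a b; rewrite /nsq paddr_eq0 ?sqr_ge0 // !sqrf_eq0 eq_complex. Qed.

Lemma nsq_gt0 z : (0 < nsq z) = (z != 0).
Proof. by rewrite lt_neqAle nsq_ge0 andbT eq_sym nsq_eq0. Qed.

Lemma nsqB_le z w : nsq (z - w) <= 2 * (nsq z + nsq w).
Proof.
case: z w => [a b] [c d]; rewrite /nsq /= -subr_ge0.
have -> : 2 * (a ^+ 2 + b ^+ 2 + (c ^+ 2 + d ^+ 2)) - ((a - c) ^+ 2 + (b - d) ^+ 2) =
  (a + c) ^+ 2 + (b + d) ^+ 2 by ring.
by rewrite addr_ge0 ?sqr_ge0.
Qed.

Lemma nsq_int (n : int) : nsq n%:~R = n%:~R ^+ 2.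
Proof.
have -> : (n%:~R : R[i]) = (n%:~R)%:C by rewrite -(rmorph_int (real_complex R)).
by rewrite /nsq /= expr0n addr0.
Qed.

Definition unit_circle (t : R) : R[i] := cos (2 * pi * t) +i* sin (2 * pi * t).

Lemma nsq_unit_circle t : nsq (unit_circle t) = 1.
Proof. by rewrite /nsq /= cos2Dsin2. Qed.

Lemma unit_circleX t n : unit_circle t ^+ n = cos (n%:R * (2 * pi * t)) +i* sin (n%:R * (2 * pi * t)).
Proof.
rewrite /unit_circle; move: (2 * pi * t) => x.
elim: n => [|n IH]; first by rewrite expr0 mul0r cos0 sin0.
rewrite exprSr IH -[n.+1%:R]natr1 mulrDl mul1r cosD sinD.
by apply/eqP; rewrite eq_complex /=; apply/andP; split; apply/eqP; ring.
Qed.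

Lemma nsq_unit_circleB t z : nsq (unit_circle t - z) = dist2 (complex.Re z) (complex.Im z) t.
Proof. by case: z. Qed.

End ComplexNorm.

Section Mahler.
Variable R : realType.
Local Open Scope complex_scope.
Let mu := @lebesgue_measure R.
Let D : set R := `[0%R, 1%R].

(* [mlog] is twice the logarithm of the Mahler measure. *)
Definition mlog (p : {poly R[i]}) : R := Rintegral mu D (fun t => ln (nsq p.[unit_circle t])).

Lemma mlog_prod (c : R[i]) (rs : seq R[i]) : c != 0 ->
  log_integrable (fun t => nsq (c *: \prod_(z <- rs) ('X - z%:P)).[unit_circle t])
    (ln (nsq c) + \sum_(z <- rs) ln (Num.max 1 (nsq z))).
Proof.
move=> c0; rewrite (_ : (fun t => _) =
   (fun t => nsq c * \prod_(z <- rs) dist2 (complex.Re z) (complex.Im z) t)); last first.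
  apply/funext => t; rewrite hornerZ nsqM horner_prod nsq_prod; congr (_ * _).
  by apply: eq_bigr => z _; rewrite hornerXsubC nsq_unit_circleB.
apply: log_integrable_mul; first by apply: log_integrable_cst; rewrite nsq_gt0.
by apply: log_integrable_prod => z; exact: log_integrable_dist2.
Qed.

Lemma mlog_log_integrable p : p != 0 ->
  log_integrable (fun t => nsq p.[unit_circle t]) (mlog p).
Proof.
move=> p0; have [rs Dp] := closed_field_poly_normal p.
have c0 : lead_coef p != 0 by rewrite lead_coef_eq0.
have [m g n i e] := mlog_prod rs c0.
by rewrite Dp; split=> //; rewrite /mlog e.
Qed.

Lemma mlog_roots (c : R[i]) (rs : seq R[i]) : c != 0 ->
  mlog (c *: \prod_(z <- rs) ('X - z%:P)) = ln (nsq c) + \sum_(z <- rs) ln (Num.max 1 (nsq z)).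
Proof. by move=> c0; have [] := mlog_prod rs c0. Qed.

Lemma mlogM p q : p != 0 -> q != 0 -> mlog (p * q) = mlog p + mlog q.
Proof.
move=> p0 q0; have := log_integrable_mul (mlog_log_integrable p0) (mlog_log_integrable q0).
case=> _ _ _ _ <-; congr fine; apply: eq_integral => t _.
by rewrite hornerM nsqM.
Qed.

Definition toC (p : {poly int}) : {poly R[i]} := map_poly intr p.

Lemma toC_eq0 p : (toC p == 0) = (p == 0).
Proof.
by rewrite -!size_poly_eq0 /toC (size_map_inj_poly (@intr_inj _)) // rmorph0.
Qed.

Lemma nsq_toC p t : nsq (toC p).[unit_circle t] = circ_re p t ^+ 2 + circ_im p t ^+ 2.
Proof.
have -> : (toC p).[unit_circle t] = circ_re p t +i* circ_im p t.
  rewrite horner_coef size_map_inj_poly ?rmorph0 //; last exact: intr_inj.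
  rewrite /circ_re /circ_im.
  have -> : (\sum_(k < size p) (p`_k)%:~R * cos (k%:R * (2 * pi * t))) +i*
      (\sum_(k < size p) (p`_k)%:~R * sin (k%:R * (2 * pi * t))) =
     \sum_(k < size p) ((p`_k)%:~R * cos (k%:R * (2 * pi * t)) +i* ((p`_k)%:~R * sin (k%:R * (2 * pi * t)))).
    elim/big_rec3: _ => [//|k x y z _ E]; rewrite -E.
    by apply/eqP; rewrite eq_complex /= !eqxx.
  apply: eq_bigr => k _; rewrite coef_map unit_circleX /=.
  have -> : ((p`_k)%:~R : R[i]) = ((p`_k)%:~R)%:C by rewrite -(rmorph_int (real_complex R)).
  by apply/eqP; rewrite eq_complex /=; apply/andP; split; apply/eqP; ring.
by [].
Qed.

Lemma mahlerE p : p != 0 -> mahler R p = expR (mlog (toC p) / 2).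
Proof.
move=> p0; congr expR; rewrite -toC_eq0 in p0.
have [_ _ _ i <-] := mlog_log_integrable p0.
rewrite mulrC -RintegralZl //.
congr fine; apply: eq_integral => t _; congr EFin.
by rewrite nsq_toC mulrC.
Qed.

Lemma mlog_ge0 p : p != 0 -> 0 <= mlog (toC p).
Proof.
move=> p0; have [rs Dp] := closed_field_poly_normal (toC p).
have lc : lead_coef (toC p) = (lead_coef p)%:~R.
  by rewrite /toC lead_coef_map_inj //; exact: intr_inj.
have c0 : lead_coef (toC p) != 0 by rewrite lead_coef_eq0 toC_eq0.
rewrite Dp mlog_roots // lc nsq_int addr_ge0 //.
  apply: ln_ge0; rewrite -rmorphXn /= ler1z.
  by have : 0 < lead_coef p ^+ 2 by [rewrite exprn_even_gt0 //= lead_coef_eq0]; move: (_ ^+ 2) => x; lia.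
by apply: sumr_ge0 => z _; apply: ln_ge0; rewrite le_max lexx.
Qed.

End Mahler.

Section LehmerRoot.
Variable R : realType.
Local Open Scope complex_scope.

Lemma horner_lehmer (K : comNzRingType) (x : K) :
  (map_poly intr lehmer_poly).[x] =
  x ^+ 10 + x ^+ 9 - x ^+ 7 - x ^+ 6 - x ^+ 5 - x ^+ 4 - x ^+ 3 + x + 1.
Proof.
rewrite /lehmer_poly map_Poly ?rmorph0 // horner_Poly /=.
by rewrite !(rmorphN, rmorph1, rmorph0); ring.
Qed.

Lemma lehmer_real_root : exists2 x : R, 47 / 40 <= x & root (map_poly intr lehmer_poly) x.
Proof.
(* 47/40 = 1.175 is just below Lehmer's number 1.17628..., and its sixth power still exceeds
   131/50. *)
have [||x /andP[x1 _] rx] := @poly_ivt R (map_poly intr lehmer_poly) (47 / 40) 2.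
- by lra.
- by rewrite !horner_lehmer; apply/andP; split; lra.
- by exists x.
Qed.

Lemma mlog_ge_root (p : {poly int}) (x : R) : p != 0 -> 1 <= x ->
  root (map_poly intr p) x -> 2 * ln x <= mlog (toC R p).
Proof.
move=> p0 x1 rx; have [rs Dp] := closed_field_poly_normal (toC R p).
have lc : lead_coef (toC R p) = (lead_coef p)%:~R.
  by rewrite /toC lead_coef_map_inj //; exact: intr_inj.
have c0 : lead_coef (toC R p) != 0 by rewrite lead_coef_eq0 toC_eq0.
have xrs : x%:C \in rs.
  have : root (toC R p) x%:C.
    have -> : toC R p = map_poly (real_complex R) (map_poly intr p).
      by rewrite -map_poly_comp; apply: eq_map_poly => n /=; rewrite rmorph_int.
    by rewrite fmorph_root.
  by rewrite Dp rootZ // root_prod_XsubC.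
rewrite Dp mlog_roots // lc nsq_int (big_rem _ xrs) /=.
have nx : nsq x%:C = x ^+ 2 by rewrite /nsq /= expr0n addr0.
have -> : Num.max 1 (nsq x%:C) = x ^+ 2.
  by rewrite nx; apply/max_idPr; rewrite -[leLHS](expr1n _ 2) ler_sqr ?nnegrE //; lra.
have -> : ln (x ^+ 2) = 2 * ln x by rewrite lnXn ?mulr_natl //; lra.
have l0 : 0 <= ln ((lead_coef p)%:~R ^+ 2 : R).
  apply: ln_ge0; rewrite -rmorphXn /= ler1z.
  by have : 0 < lead_coef p ^+ 2 by [rewrite exprn_even_gt0 //= lead_coef_eq0]; move: (_ ^+ 2) => k; lia.
have s0 : 0 <= \sum_(z <- rem x%:C rs) ln (Num.max 1 (nsq z)).
  by apply: sumr_ge0 => z _; apply: ln_ge0; rewrite le_max lexx.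
by lra.
Qed.

Lemma lehmer_poly_neq0 : lehmer_poly != 0.
Proof.
apply/eqP=> E; have := @horner_lehmer int 1.
by rewrite E map_poly0 horner0 !expr1n.
Qed.

Lemma mlog_lehmer_ge : 2 * ln (47 / 40) <= mlog (toC R lehmer_poly).
Proof.
have [x x1 rx] := lehmer_real_root.
apply: (@le_trans _ _ (2 * ln x)); last by apply: mlog_ge_root rx; [exact: lehmer_poly_neq0 | lra].
by rewrite ler_pM2l // ler_ln ?posrE; lra.
Qed.

End LehmerRoot.

(** * Products over translates by roots of unity *)

Section RootProducts.
Variable R : realType.
Local Open Scope complex_scope.
Implicit Types z w : R[i].

Lemma complex_prim_root_exists n : (0 < n)%N -> exists z : R[i], n.-primitive_root z.
Proof.
pose p : {poly R[i]} := 'X^n - 1; have [r Dp] := closed_field_poly_normal p.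
move=> n_gt0; rewrite (monicP _) ?monicXnsubC // scale1r in Dp.
have rn1: all n.-unity_root r by apply/allP=> z; rewrite -root_prod_XsubC -Dp.
have sz_r: (n < (size r).+1)%N.
  by rewrite -(size_prod_XsubC r id) -Dp size_XnsubC.
have [|z] := hasP (has_prim_root n_gt0 rn1 _ sz_r); last by exists z.
by rewrite -separable_prod_XsubC -Dp separable_Xn_sub_1 // pnatr_eq0 -lt0n.
Qed.

Lemma nsq_prim_root n z : n.-primitive_root z -> nsq z = 1.
Proof.
move=> pz; have n0 := prim_order_gt0 pz; apply/eqP.
by rewrite -(pexpr_eq1 n0 (nsq_ge0 z)) -nsqX (prim_expr_order pz) nsq1.
Qed.

Lemma prod_root_shift n w y z : n.-primitive_root w -> y != 0 ->
  \prod_(0 <= j < n) (z - y * w ^+ j) = z ^+ n - y ^+ n.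
Proof.
move=> pw y0.
have := congr1 (fun p => p.[z / y]) (factor_Xn_sub_1 pw).
rewrite horner_prod !(hornerD, hornerN, hornerXn, hornerC) => E.
transitivity (y ^+ n * ((z / y) ^+ n - 1)).
  rewrite -E -[n in y ^+ n]subn0 -prodr_const_nat -big_split /=.
  by apply: eq_bigr => j _; rewrite hornerXsubC mulrBr mulrCA divff // mulr1.
by rewrite exprMn exprVn mulrBr mulr1 mulrCA divff ?mulr1 // expf_neq0.
Qed.

Lemma prod_root_shift_mul n g w y z : n.-primitive_root w -> y != 0 ->
  \prod_(0 <= j < g * n) (z - y * w ^+ j) = (z ^+ n - y ^+ n) ^+ g.
Proof.
move=> pw y0; elim: g => [|g IH]; first by rewrite mul0n big_geq.
rewrite mulSn addnC (@big_cat_nat _ _ _ (g * n)) ?leq_addr //= IH exprSr; congr (_ * _).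
rewrite -{1}[(g * n)%N]add0n big_addn addKn -(prod_root_shift z pw y0).
apply: eq_bigr => j _; rewrite exprD mulnC exprM (prim_expr_order pw) expr1n mulr1 //.
Qed.

End RootProducts.

Section FastVariable.
Variable R : realType.
Local Open Scope complex_scope.
Implicit Types z w : R[i].

(* [131 / 50] exceeds the larger root of [s + 1 / s = 3]. *)
Definition sigma_bound (c : R) : R := if c ^+ 2 <= 4 then 1 else (131 / 50) ^+ 2.

Lemma nsqV z : nsq z^-1 = (nsq z)^-1.
Proof.
have [->|z0] := eqVneq z 0; first by rewrite invr0 /nsq /= !expr0n addr0 invr0.
by apply: (mulfI (_ : nsq z != 0)); rewrite ?nsq_eq0 // -nsqM !divff ?nsq1 ?nsq_eq0.
Qed.

Lemma exists_sigma (c : R) : c ^+ 2 <= 9 ->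
  exists s : R[i], [/\ s != 0, s + s^-1 = c%:C, nsq s <= sigma_bound c & (nsq s)^-1 <= sigma_bound c].
Proof.
move=> c9; rewrite /sigma_bound; have [c4|c4] := leP (c ^+ 2) 4.
  pose d := Num.sqrt (1 - (c / 2) ^+ 2).
  have d2 : d ^+ 2 = 1 - (c / 2) ^+ 2 by rewrite sqr_sqrtr //; nra.
  have n1 : nsq (c / 2 +i* d) = 1 by rewrite /nsq /= d2; ring.
  exists (c / 2 +i* d); rewrite n1 invr1 !lexx; split=> //; first by rewrite -nsq_eq0 n1 oner_eq0.
  have s0 : c / 2 +i* d != 0 by rewrite -nsq_eq0 n1 oner_eq0.
  have -> : (c / 2 +i* d)^-1 = c / 2 -i* d.
    apply: (mulfI s0); rewrite divff //; apply/eqP; rewrite eq_complex /=.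
    apply/andP; split; apply/eqP; last by ring.
    by rewrite -[LHS]n1 /nsq /=; ring.
  by apply/eqP; rewrite eq_complex /= subrr eqxx andbT; apply/eqP; field.
pose d := Num.sqrt (c ^+ 2 - 4).
have d2 : d ^+ 2 = c ^+ 2 - 4 by rewrite sqr_sqrtr //; lra.
have d0 : 0 <= d by apply: sqrtr_ge0.
(* 56/25 exceeds the square root of 5, and (3 + 56/25) / 2 = 131/50. *)
have d1 : d <= 56 / 25 by rewrite -ler_sqr ?nnegrE // d2; lra.
have cb : - 3 <= c <= 3 by apply/andP; split; nra.
have prod1 : (c + d) / 2 * ((c - d) / 2) = 1.
  have -> : (c + d) / 2 * ((c - d) / 2) = (c ^+ 2 - d ^+ 2) / 4 by field.
  by rewrite d2; field.
have s0 : (c + d) / 2 != 0 by apply/eqP=> E; move: prod1; rewrite E mul0r => /esym/eqP; rewrite oner_eq0.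
have sV : ((c + d) / 2)^-1 = (c - d) / 2 by apply: (mulfI s0); rewrite divff.
have n x : nsq x%:C = x ^+ 2 by rewrite /nsq /= expr0n addr0.
exists ((c + d) / 2)%:C; split.
- by rewrite -nsq_eq0 n sqrf_eq0.
- by rewrite -(fmorphV (real_complex R)) sV -(rmorphD (real_complex R)); congr (_%:C); field.
- by case/andP: cb => cb1 cb2; rewrite n; nra.
- by case/andP: cb => cb1 cb2; rewrite n -exprVn sV; nra.
Qed.

Lemma sigma_bound_ge1 (c : R) : 1 <= sigma_bound c.
Proof. by rewrite /sigma_bound; case: ifP => _ //; lra. Qed.

Lemma unit_circleD_inv (t : R) :
  unit_circle t + (unit_circle t)^-1 = (2 * cos (2 * pi * t))%:C.
Proof.
have z0 : unit_circle t != 0 by rewrite -nsq_eq0 nsq_unit_circle oner_eq0.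
have -> : (unit_circle t)^-1 = cos (2 * pi * t) -i* sin (2 * pi * t).
  apply: (mulfI z0); rewrite divff //; apply/eqP; rewrite eq_complex /=.
  apply/andP; split; apply/eqP; last by ring.
  by rewrite -[LHS](cos2Dsin2 (2 * pi * t)); ring.
by apply/eqP; rewrite eq_complex /= subrr eqxx andbT; apply/eqP; ring.
Qed.

(** Dividing by v^m, of modulus 1, leaves v^m + v^-m + e - v^n - v^-n, in which the first three
    terms depend on [t] alone. *)
Lemma horner_quinom_unit (e : int) m n (v : R[i]) (t : R) : (n < m)%N ->
  v ^+ m = unit_circle t -> 
  nsq (toC R (quinom e m n)).[v] =
  nsq ((2 * cos (2 * pi * t) + e%:~R)%:C - (v ^+ n + (v ^+ n)^-1)).
Proof.
move=> nm vm.
have z0 : v ^+ m != 0 by rewrite vm -nsq_eq0 nsq_unit_circle oner_eq0.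
have v0 : v != 0 by apply: contraNneq z0 => ->; rewrite expr0n; case: m nm {vm} => // m; rewrite eqxx.
have y0 : v ^+ n != 0 by rewrite expf_neq0.
have -> : (toC R (quinom e m n)).[v] = v ^+ m *
   ((2 * cos (2 * pi * t) + e%:~R)%:C - (v ^+ n + (v ^+ n)^-1)).
  have -> : (2 * cos (2 * pi * t) + e%:~R)%:C = v ^+ m + (v ^+ m)^-1 + e%:~R :> R[i].
    by rewrite vm unit_circleD_inv rmorphD /= rmorph_int.
  rewrite /toC quinomE !(rmorphD, rmorphN) /= map_polyZ !map_polyXn rmorph1.
  rewrite !(hornerD, hornerN, hornerZ, hornerXn, hornerC).
  have Emn : v ^+ (m - n) = v ^+ m / v ^+ n.
    by apply: (mulIf y0); rewrite -exprD subnK ?(ltnW nm) // divfK.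
  by rewrite Emn mulnC exprM exprD; field; rewrite y0 z0.
by rewrite nsqM vm nsq_unit_circle mul1r.
Qed.

Lemma sum_inv_le (S s : R) : 0 < s -> s <= S -> s^-1 <= S -> 1 <= S ->
  (2 * (s + 1)) * (2 * (s^-1 + 1)) <= 16 * S.
Proof.
move=> s0 sS sS' S1.
have -> : (2 * (s + 1)) * (2 * (s^-1 + 1)) = 4 * (2 + s + s^-1) by field; rewrite gt_eqF.
by lra.
Qed.

(* As [y * w ^+ j] runs over the [m]-th roots of e^(2 i pi t), its [m]-th power stays fixed
   while its [n]-th power runs over roots of unity times [V]; so if [s + 1 / s] is the frozen
   coefficient, the product is a power of |s^m1 - V^m1|^2 |s^-m1 - V^m1|^2. *)
Lemma nsq_prod_quinom_le (e : int) m n (w y : R[i]) (t : R) : (0 < n < m)%N -> e = 1 \/ e = -1 ->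
  m.-primitive_root w -> y ^+ m = unit_circle t ->
  \prod_(0 <= j < m) nsq (toC R (quinom e m n)).[y * w ^+ j] <=
  16 ^+ gcdn n m * sigma_bound (2 * cos (2 * pi * t) + e%:~R) ^+ m.
Proof.
move=> /andP[n0 nm] he pw ym; set c := 2 * cos _ + _; set g := gcdn n m; set m1 := (m %/ g)%N.
have m0 : (0 < m)%N by lia.
have Dm : m = (g * m1)%N by rewrite /m1 mulnC divnK // dvdn_gcdr.
have m10 : (0 < m1)%N by rewrite lt0n; apply/eqP=> E; rewrite E muln0 in Dm; rewrite Dm in m0.
have c9 : c ^+ 2 <= 9.
  have := cos_geN1 (2 * pi * t); have := cos_le1 (2 * pi * t); rewrite /c.
  by move: (cos _) => x x1 x2; case: he => ->; rewrite ?rmorphN1 ?rmorph1; nra.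
have [s [s0 Es sS sS']] := exists_sigma c9.
set S := sigma_bound c in sS sS' *; have S1 : 1 <= S by exact: sigma_bound_ge1.
have y0 : y != 0.
  apply/eqP=> y0; have := nsq_unit_circle t; rewrite -ym nsqX y0 /nsq /= !expr0n addr0 /=.
  by rewrite expr0n; case: (m) m0 => // k _ /eqP; rewrite eq_sym oner_eq0.
have ny : nsq y = 1.
  by apply/eqP; rewrite -(pexpr_eq1 m0 (nsq_ge0 y)) -nsqX ym nsq_unit_circle.
pose V := y ^+ n; have V0 : V != 0 by rewrite expf_neq0.
have nV : nsq V = 1 by rewrite nsqX ny expr1n.
have pu : m1.-primitive_root (w ^+ n) := exp_prim_root pw n.
pose u := w ^+ n.
have nw j : nsq (w ^+ j) = 1 by rewrite nsqX (nsq_prim_root pw) expr1n.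
(* With c = s + 1/s, v (c - v - 1/v) = - (s - v) (1/s - v), and |v| = 1. *)
have factor j : nsq (toC R (quinom e m n)).[y * w ^+ j] =
    nsq ((s - V * u ^+ j) * (s^-1 - V * u ^+ j)).
  rewrite (@horner_quinom_unit e m n _ t) // -/c; last first.
    by rewrite exprMn -exprM mulnC exprM (prim_expr_order pw) expr1n mulr1.
  have -> : (y * w ^+ j) ^+ n = V * u ^+ j by rewrite exprMn -!exprM mulnC.
  set v := V * u ^+ j.
  have nv : nsq v = 1 by rewrite nsqM nV mul1r -exprM nw.
  have v0 : v != 0 by rewrite -nsq_eq0 nv oner_eq0.
  rewrite -Es -[LHS]mul1r -nv -nsqM -[RHS]nsqN; congr nsq; field.
  by rewrite s0 v0.
under eq_bigr do rewrite factor nsqM.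
rewrite big_split /= -!nsq_prod {1 2}Dm !(prod_root_shift_mul _ _ pu V0) !nsqX -exprMn.
have ns0 : 0 < nsq s by rewrite nsq_gt0.
rewrite [X in _ <= _ * _ ^+ X]Dm mulnC exprM -exprMn; apply: lerXn2r; rewrite ?nnegrE.
- by rewrite mulr_ge0 ?nsq_ge0.
- by rewrite mulr_ge0 ?exprn_ge0 //; lra.
apply: (@le_trans _ _ ((2 * (nsq s ^+ m1 + 1)) * (2 * ((nsq s ^+ m1)^-1 + 1)))).
  apply: ler_pM; rewrite ?nsq_ge0 //.
    by apply: le_trans (nsqB_le _ _) _; rewrite !nsqX ny !expr1n.
  by apply: le_trans (nsqB_le _ _) _; rewrite !nsqX ny !expr1n nsqV exprVn.
apply: sum_inv_le.
- by rewrite exprn_gt0.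
- by apply: lerXn2r; rewrite ?nnegrE ?nsq_ge0 //; lra.
- by rewrite -exprVn; apply: lerXn2r; rewrite ?nnegrE ?invr_ge0 ?nsq_ge0 //; lra.
- exact: exprn_ege1.
Qed.

End FastVariable.

Section StepBound.
Variable R : realType.
Let mu := @lebesgue_measure R.
Implicit Types t : R.

(** The triple angle formula gives (x + 1) (2 x - 1)^2 = 0 for x = cos(pi / 3) > 0. *)
Lemma cos_pi_div3 : cos (pi / 3) = 1 / 2 :> R.
Proof.
have p0 := pi_gt0 R.
have x0 : 0 < cos (pi / 3 : R).
  by apply: cos_gt0_pihalf; apply/andP; split; move: (pi : R) p0 => p p0; lra.
have : cos (pi / 3 + pi / 3 + pi / 3 : R) = -1.
  by have -> : pi / 3 + pi / 3 + pi / 3 = 0 + pi :> R by [field]; rewrite cosDpi cos0.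
rewrite !cosD !sinD; move: (cos2Dsin2 (pi / 3 : R)).
move: (cos _) (sin _) x0 => x y x0 E1 E3.
have : (x + 1) * (2 * x - 1) ^+ 2 = 0.
  have y2 : y ^+ 2 = 1 - x ^+ 2 by rewrite -E1; ring.
  have -> : (x + 1) * (2 * x - 1) ^+ 2 = 4 * x ^+ 3 - 3 * x + 1 by ring.
  have : (x * x - y * y) * x - (y * x + x * y) * y = 4 * x ^+ 3 - 3 * x.
    have -> : (x * x - y * y) * x - (y * x + x * y) * y = x ^+ 3 - 3 * x * y ^+ 2 by ring.
    by rewrite y2; ring.
  by move=> <-; rewrite E3 addNr.
move/eqP; rewrite mulf_eq0 sqrf_eq0 => /orP[]/eqP; lra.
Qed.

Lemma ler_cos (x y : R) : 0 <= x <= pi -> 0 <= y <= pi -> (cos x <= cos y) = (y <= x).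
Proof. by move=> x0 y0; rewrite !leNgt ltr_cos // in_itv. Qed.

Lemma cos_le_half t : 1 / 6 <= t <= 5 / 6 -> cos (2 * pi * t) <= 1 / 2.
Proof.
have p0 := pi_gt0 R.
have H (x : R) : 1 / 6 <= x <= 1 / 2 -> cos (2 * pi * x) <= 1 / 2.
  move=> /andP[x1 x2]; rewrite -cos_pi_div3 ler_cos.
  - have -> : 2 * pi * x = pi * (2 * x) by ring.
    by rewrite ler_pM2l //; lra.
  - have -> : 2 * pi * x = pi * (2 * x) by ring.
    by rewrite mulr_ge0 ?(ltW p0) ?ler_piMr ?(ltW p0) //; lra.
  - by apply/andP; split; move: (pi : R) p0 => p p0; lra.
move=> /andP[t1 t2]; have [th|th] := leP t (1 / 2); first by apply: H; lra.
rewrite (_ : cos (2 * pi * t) = cos (2 * pi * (1 - t))); first by apply: H; lra.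
by rewrite -cosN -(cosD2pi (- _)); congr cos; rewrite -mulr_natr; ring.
Qed.

Lemma cos_ge_Nhalf t : 0 <= t <= 1 -> ~~ (1 / 3 <= t <= 2 / 3) -> - (1 / 2) <= cos (2 * pi * t).
Proof.
have p0 := pi_gt0 R.
have c2 : cos (2 * pi / 3) = - (1 / 2) :> R.
  have -> : 2 * pi / 3 = - (pi / 3) + pi :> R by field.
  by rewrite cosDpi cosN cos_pi_div3.
have H (x : R) : 0 <= x <= 1 / 3 -> - (1 / 2) <= cos (2 * pi * x).
  move=> /andP[x1 x2]; rewrite -c2 ler_cos.
  - have -> : 2 * pi * x = pi * (2 * x) by ring.
    have -> : 2 * pi / 3 = pi * (2 / 3) :> R by field.
    by rewrite ler_pM2l //; lra.
  - by apply/andP; split; move: (pi : R) p0 => p p0; lra.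
  - have -> : 2 * pi * x = pi * (2 * x) by ring.
    by rewrite mulr_ge0 ?(ltW p0) ?ler_piMr ?(ltW p0) //; lra.
move=> /andP[t0 t1]; rewrite negb_and -!ltNge => /orP[t2|t2]; first by apply: H; lra.
rewrite (_ : cos (2 * pi * t) = cos (2 * pi * (1 - t))); first by apply: H; lra.
by rewrite -cosN -(cosD2pi (- _)); congr cos; rewrite -mulr_natr; ring.
Qed.

Lemma integral_indic_sub (a b : R) : 0 <= a -> a <= b -> b <= 1 ->
  mu.-integrable `[0%R, 1%R] (EFin \o (\1_(`[a, b]%classic : set R) : R -> R)) /\
  Rintegral mu `[0, 1] (\1_(`[a, b]%classic : set R) : R -> R) = b - a.
Proof.
move=> a0 ab b1; have mab : measurable (`[a, b]%classic : set R) by exact: measurable_itv.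
have E : (\int[mu]_(x in `[0%R, 1%R]) ((\1_(`[a, b]%classic : set R) x)%:E : \bar R) = (b - a)%:E)%E.
  rewrite integral_indic // setIidl; last first.
    by move=> x /=; rewrite !in_itv /= => /andP[ax xb]; apply/andP; split; lra.
  transitivity (@lebesgue_measure R [set` Interval (BLeft a) (BRight b)]); first by [].
  rewrite lebesgue_measure_itv /= lte_fin; move: ab; rewrite le_eqVlt => /orP[/eqP ->|->].
    by rewrite ltxx subrr.
  by rewrite -EFinD.
split; last by rewrite /Rintegral E.
apply/integrableP; split; first by apply/measurable_EFinP; exact: measurable_indic.
under eq_integral do rewrite /= ger0_norm //.
by rewrite E ltry.
Qed.

(* The set where [|2 cos (2 pi t) + e| > 2] has measure [1 / 3]. *)
Lemma Rintegral_sigma_bound (q : R -> R) (v k0 k1 : R) (e : int) : e = 1 \/ e = -1 ->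
  0 <= k1 -> log_integrable q v ->
  (forall t, 0 <= t <= 1 -> ln (q t) <= k0 + k1 * ln (sigma_bound (2 * cos (2 * pi * t) + e%:~R))) ->
  v <= k0 + k1 * (2 / 3 * ln (131 / 50)).
Proof.
move=> he k10 [mq _ _ iq <-] H.
set B := ln (131 / 50); have B0 : 0 <= B by apply: ln_ge0; lra.
have lnB : ln ((131 / 50) ^+ 2) = 2 * B :> R by rewrite lnXn; [rewrite -[LHS]mulr_natl | lra].
have sb1 c : c ^+ 2 <= 4 -> ln (sigma_bound c) = 0 :> R by move=> c4; rewrite /sigma_bound c4 ln1.
have sb2 (c : R) : ln (sigma_bound c) <= 2 * B.
  by rewrite /sigma_bound; case: ifP => _; [rewrite ln1 mulr_ge0 | rewrite lnB].
clearbody B.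
(* [h] is the indicator of a set containing every t where the bound exceeds 1: the complement of
   [1/6, 5/6], off which cos > 1/2 cannot occur inside, for e = 1, and [1/3, 2/3], outside which cos
   >= -1/2, for e = -1. *)
have [h [ih eh hh]] : exists h : R -> R, [/\ mu.-integrable `[0%R, 1%R] (EFin \o h),
    Rintegral mu `[0, 1] h = 1 / 3 &
    forall t, 0 <= t <= 1 -> ln (sigma_bound (2 * cos (2 * pi * t) + e%:~R)) <= 2 * B * h t].
  case: he => ->.
  - have [||| i E] := @integral_indic_sub (1 / 6) (5 / 6); [lra..|].
    have i1 := integrable_cst01 (1 : R).
    exists (fun t => 1 - \1_(`[(1 / 6)%R, (5 / 6)%R]%classic : set R) t); split.
    + by have := integrableB _ i1 i; apply; exact: measurable_itv.
    + by rewrite RintegralB // E Rintegral01_cst; lra.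
    move=> t t01; rewrite indicE; case: (boolP (t \in _)) => [|nt].
      rewrite inE /= in_itv /= => /cos_le_half ct; rewrite subrr mulr0 sb1 //.
      by have := cos_geN1 (2 * pi * t); move: ct; rewrite rmorph1; move: (cos _) => x; nra.
    by rewrite subr0 mulr1.
  have [||| i E] := @integral_indic_sub (1 / 3) (2 / 3); [lra..|].
  exists (\1_(`[(1 / 3)%R, (2 / 3)%R]%classic : set R)); split=> //; first by rewrite E; lra.
  move=> t t01; rewrite indicE; case: (boolP (t \in _)) => [_|]; first by rewrite mulr1.
  rewrite mulr0; move=> nt; rewrite sb1 //.
  have : ~~ (1 / 3 <= t <= 2 / 3).
    by apply: contra nt => ht; rewrite inE /= in_itv.
  move/(cos_ge_Nhalf t01); have := cos_le1 (2 * pi * t); rewrite rmorphN1.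
  by move: (cos _) => x; nra.
have ic := integrable_cst01 k0.
have ikh : mu.-integrable `[0%R, 1%R] (EFin \o fun t => k1 * (2 * B) * h t).
  by have := integrableZl _ (k1 * (2 * B)) ih; apply; exact: measurable_itv.
have ikk : mu.-integrable `[0%R, 1%R] (EFin \o fun t => k0 + k1 * (2 * B) * h t).
  by have := integrableD _ ic ikh; apply; exact: measurable_itv.
apply: (@le_trans _ _ (Rintegral mu `[0, 1] (fun t => k0 + k1 * (2 * B) * h t))).
  apply: le_Rintegral => // t; rewrite /= in_itv /= => t01.
  apply: le_trans (H t t01) _; rewrite lerD2l -(mulrA k1) ler_wpM2l //.
  exact: hh.
rewrite RintegralD // Rintegral01_cst RintegralZl // eh.
by rewrite lerD2l; apply/eqP/eqP; lra.
Qed.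

End StepBound.

Section UpperBound.
Variable R : realType.
Local Open Scope complex_scope.

Lemma max1X (x : R) n : 0 <= x -> Num.max 1 (x ^+ n) = Num.max 1 x ^+ n.
Proof.
move=> x0; have [x1|x1] := leP 1 x.
  by apply/max_idPr; exact: exprn_ege1.
by rewrite expr1n; apply/max_idPl; apply: exprn_ile1 => //; exact: ltW.
Qed.

(** Since max(1, |z^m|^2) = max(1, |z|^2)^m, the left side is exactly the logarithmic integral of
    the monic polynomial with roots z^m, so the pointwise bound on the product over translates can
    be integrated. *)
Lemma mlog_quinom_le (e : int) m n : (0 < n < m)%N -> e = 1 \/ e = -1 ->
  m%:R * mlog (toC R (quinom e m n)) <=
  (gcdn n m)%:R * ln 16 + m%:R * (2 / 3 * ln (131 / 50)).
Proof.
move=> nm he; set p := toC R _; set g := gcdn n m.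
have m0 : (0 < m)%N by lia.
have lp : lead_coef p = 1.
  rewrite /p /toC lead_coef_map_inj //; last exact: intr_inj.
  have := coef_quinom e m n (2 * m); rewrite lead_coefE (size_quinom _ _ _ he nm) /= => ->.
  have [h1 h2 h3 h4] : [/\ (2 * m == 0)%N = false, (2 * m == m - n)%N = false,
    (2 * m == m)%N = false & (2 * m == m + n)%N = false] by split; lia.
  by rewrite h1 h2 h3 h4 eqxx mulr0 !subr0 !add0r.
have [rs Dp] := closed_field_poly_normal p; rewrite lp scale1r in Dp.
have one0 : (1 : R[i]) != 0 by exact: oner_neq0.
have E : m%:R * mlog p = ln (nsq (1 : R[i])) + \sum_(z <- [seq z ^+ m | z <- rs]) ln (Num.max 1 (nsq z)).
  rewrite Dp -[\prod_(z <- rs) _]scale1r mlog_roots // nsq1 ln1 !add0r big_map mulr_sumr.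
  apply: eq_bigr => z _; rewrite nsqX max1X ?nsq_ge0 // lnXn ?mulr_natl //.
  by rewrite lt_max ltr01.
have [w pw] := complex_prim_root_exists R m0.
have := mlog_prod [seq z ^+ m | z <- rs] one0; rewrite -E => LI.
apply: (Rintegral_sigma_bound he (ler0n _ m) LI) => t t01.
set S := sigma_bound _; have S1 : 1 <= S := sigma_bound_ge1 _.
pose y : R[i] := unit_circle (t / m%:R).
have ym : y ^+ m = unit_circle t.
  rewrite unit_circleX /unit_circle.
  have -> : m%:R * (2 * pi * (t / m%:R)) = 2 * pi * t by field; rewrite pnatr_eq0 -lt0n.
  by [].
have y0 : y != 0 by rewrite -nsq_eq0 nsq_unit_circle oner_eq0.
have -> : nsq (1 *: \prod_(z <- [seq z ^+ m | z <- rs]) ('X - z%:P)).[unit_circle t] =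
    \prod_(0 <= j < m) nsq p.[y * w ^+ j].
  rewrite scale1r horner_prod nsq_prod big_map.
  transitivity (\prod_(z <- rs) \prod_(0 <= j < m) nsq (z - y * w ^+ j)).
    apply: eq_bigr => z _; rewrite -nsq_prod (prod_root_shift z pw y0) hornerXsubC ym.
    by rewrite -nsqN opprB.
  rewrite exchange_big /=; apply: eq_bigr => j _.
  rewrite Dp horner_prod nsq_prod; apply: eq_bigr => z _.
  by rewrite hornerXsubC -nsqN opprB.
have le := nsq_prod_quinom_le nm he pw ym; rewrite -/p -/S -/g in le.
have X1 : 1 <= 16 ^+ g * S ^+ m :> R.
  by apply: mulr_ege1; apply: exprn_ege1 => //; rewrite ler1n.
have lnX : ln (16 ^+ g * S ^+ m) = g%:R * ln 16 + m%:R * ln S :> R.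
  rewrite lnM ?posrE ?exprn_gt0 //; last by lra.
  by rewrite !lnXn ?mulr_natl //; lra.
(* At a zero of the product the logarithm is 0 by convention, and the bound, being the logarithm of
   a number at least 1, still holds. *)
rewrite -lnX; have [q0|q0] := eqVneq (\prod_(0 <= j < m) nsq p.[y * w ^+ j]) 0.
  by rewrite q0 ln0 // ln_ge0.
rewrite ler_ln ?posrE //; last by lra.
by rewrite lt_neqAle eq_sym q0 prodr_ge0 // => j _; exact: nsq_ge0.
Qed.

End UpperBound.

(** * Irreducibility *)

Section Irreducibility.
Variable R : realType.

Lemma mlogZ_sign (s : int) (p : {poly int}) : s = 1 \/ s = -1 ->
  mlog (toC R (s *: p)) = mlog (toC R p).
Proof.
move=> hs; congr fine; apply: eq_integral => t _; congr (ln _)%:E.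
rewrite /toC map_polyZ hornerZ nsqM.
by case: hs => ->; rewrite ?rmorphN ?rmorph1 ?nsqN nsq1 mul1r.
Qed.

Lemma toCM (p q : {poly int}) : toC R (p * q) = toC R p * toC R q.
Proof. exact: rmorphM. Qed.

Lemma mlog_toCM (p q : {poly int}) : p != 0 -> q != 0 ->
  mlog (toC R (p * q)) = mlog (toC R p) + mlog (toC R q).
Proof. by move=> p0 q0; rewrite toCM mlogM ?toC_eq0. Qed.

Lemma nonunit_irreducible_factor (p : {poly int}) : p != 0 -> p \isn't a GRing.unit ->
  exists2 q : {poly int}, irreducibleZ q & exists r, p = q * r.
Proof.
move=> p0 pu; have [[|q s] irr Ds] := irreducibleZ_factorization p p0 pu.
  by rewrite Ds big_nil unitr1 in pu.
exists q; first by apply: irr; rewrite mem_head.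
by exists (\prod_(x <- s) x); rewrite Ds big_cons.
Qed.

(** Lehmer's Conjecture applies to an irreducible factor of q: it is not cyclotomic by (a), nor x or
    - x because [GT] has a nonzero constant term. The cofactor has nonnegative [mlog]. *)
Lemma lehmer_mlog_factor (a b : nat) (q r : {poly int}) : LehmerConjecture R ->
  (0 < a)%N -> (0 < b)%N -> a <> b -> GT a b %/ CT a b = q * r ->
  q \isn't a GRing.unit -> 2 * ln (47 / 40) <= mlog (toC R q).
Proof.
move=> leh a0 b0 ab E qu.
have f0 : GT a b %/ CT a b != 0.
  by apply/eqP=> f0; have := GT_neq0 a b; rewrite -divCTK f0 mul0r eqxx.
have q0 : q != 0 by apply: contraNneq f0 => q0; rewrite E q0 mul0r.
have [p irr [r' Dq]] := nonunit_irreducible_factor q0 qu.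
have [p0 _ _] := irr.
have r'0 : r' != 0 by apply: contraNneq q0 => r'0; rewrite Dq r'0 mulr0.
have noPhi : ~ is_cyclotomic p.
  move=> [k k0 Dp]; have /negP := GT_div_CT_no_Phi _ _ _ a0 b0 k0; apply.
  rewrite E Dq; case: Dp => ->.
    by rewrite -mulrA dvdp_mulr.
  by rewrite mulNr mulNr -mulrN -mulrA dvdp_mulr.
have G0 : (GT a b)`_0 != 0.
  have [s [e [hs he ->]]] := GT_quinom a b ab.
  rewrite coefZ (quinom_coef0 _ _ _ he (minn_lt_maxn _ _ a0 b0 ab)) mulr1.
  by case: hs => ->.
have pc0 : p`_0 != 0.
  by apply: contraNneq G0 => pc0; rewrite -divCTK E Dq !coef0M pc0 !mul0r.
have pX : p <> 'X by move=> pX; rewrite pX coefX eqxx in pc0.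
have pNX : p <> - 'X by move=> pX'; rewrite pX' coefN coefX eqxx in pc0.
have := leh p irr noPhi pX pNX.
rewrite !mahlerE // ?lehmer_poly_neq0 // ler_expR => lep.
have L := mlog_lehmer_ge R.
rewrite Dq mlog_toCM //.
have := mlog_ge0 R r'0.
by lra.
Qed.

Lemma part_c : LehmerConjecture R ->
     exists C : R, forall a b : nat, (0 < a)%N -> (0 < b)%N ->
       C < Num.max (a%:R / b%:R) (b%:R / a%:R) ->
       irreducibleZ (GT a b %/ CT a b).
Proof.
(* [d > 0] says that [(47 / 40) ^ 2], a lower bound for the squared measure of Lehmer's
   polynomial, exceeds [(131 / 50) ^ (1 / 3)], an upper bound for the limit measure of [GT]. *)
move=> leh; pose d : R := 6 * ln (47 / 40) - ln (131 / 50).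
have d0 : 0 < d.
  rewrite subr_gt0 (_ : 6 * ln (47 / 40) = ln ((47 / 40) ^+ 6)); last first.
    by rewrite lnXn; [rewrite -[RHS]mulr_natl | lra].
  by rewrite ltr_ln ?posrE; lra.
have l16 : 0 < ln 16 :> R by apply: ln_gt0; rewrite ltr1n.
(* 14 g < m makes deg CT <= 28 g smaller than deg GT = 2 m. The other term is solved from g ln 16 +
   m (2/3) ln(131/50) < 4 m ln(47/40), which is g (3/2) ln 16 < m d. *)
exists (14 + 3 / 2 * ln 16 / d) => a b a0 b0 Cab.
have K0 : 0 < 3 / 2 * ln 16 / d by rewrite divr_gt0 // mulr_gt0.
pose m := maxn a b; pose n := minn a b; pose g := gcdn a b.
have Cmn : 14 + 3 / 2 * ln 16 / d < m%:R / n%:R.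
  move: Cab; rewrite /m /n; case: (leqP a b) => lab; rewrite lt_max => /orP[] //.
    move=> h; apply: (lt_le_trans h).
    apply: (@le_trans _ _ 1); first by rewrite ler_pdivrMr ?ltr0n // mul1r ler_nat.
    by rewrite ler_pdivlMr ?ltr0n // mul1r ler_nat.
  move=> h; apply: (lt_le_trans h).
  apply: (@le_trans _ _ 1); first by rewrite ler_pdivrMr ?ltr0n // mul1r ler_nat ltnW.
  by rewrite ler_pdivlMr ?ltr0n // mul1r ler_nat ltnW.
have n0 : (0 < n)%N by rewrite /n leq_min a0.
have m0 : (0 < m)%N by rewrite /m leq_max a0.
have g0 : (0 < g)%N by rewrite gcdn_gt0 a0.
have gn : (g <= n)%N by rewrite /n /g; case: (leqP a b) => _; rewrite dvdn_leq ?dvdn_gcdl ?dvdn_gcdr.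
have gE : gcdn n m = g.
  by rewrite /n /m /g; case: (leqP a b) => _ //; rewrite gcdnC.
have CmG : 14 + 3 / 2 * ln 16 / d < m%:R / g%:R.
  apply: lt_le_trans Cmn _; rewrite ler_pM2l ?ltr0n // lef_pV2 ?posrE ?ltr0n //.
  by rewrite ler_nat.
rewrite ltr_pdivlMr ?ltr0n // in CmG.
have gR : 0 < g%:R :> R by rewrite ltr0n.
have m14 : (14 * g < m)%N.
  rewrite -(ltr_nat R) natrM; apply: le_lt_trans CmG.
  by rewrite ler_pM2r // lerDl ltW.
have ab : a <> b.
  move=> E; move: m14; rewrite /m /g E maxnn gcdnn; lia.
have nm : (0 < n < m)%N := minn_lt_maxn _ _ a0 b0 ab.
have [s [e [hs he DG]]] := GT_quinom a b ab; rewrite -/m -/n in DG.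
have upper : mlog (toC R (GT a b)) < 4 * ln (47 / 40).
  rewrite DG mlogZ_sign //.
  have := mlog_quinom_le R nm he; rewrite gE => up.
  have mR : 0 < m%:R :> R by rewrite ltr0n.
  rewrite -(ltr_pM2l mR); apply: le_lt_trans up _.
  have key : g%:R * (3 / 2 * ln 16) < m%:R * d.
    rewrite -ltr_pdivrMr //.
    have -> : g%:R * (3 / 2 * ln 16) / d = 3 / 2 * ln 16 / d * g%:R by ring.
    apply: le_lt_trans CmG.
    by rewrite ler_pM2r // lerDr.
  move: key; rewrite /d; nra.
have f0 : GT a b %/ CT a b != 0.
  by apply/eqP=> f0; have := GT_neq0 a b; rewrite -divCTK f0 mul0r eqxx.
split=> //.
  rewrite polyZ_unitE negb_and; apply/orP; left.
  have sz := size_GT a b a0 b0 ab; rewrite -divCTK size_Mmonic ?CT_monic // in sz.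
  have := size_CT a b a0; rewrite -/g => sC.
  by apply/eqP=> s1; rewrite s1 -/m in sz; lia.
move=> q r E.
have [qu|qu] := boolP (q \is a GRing.unit); first by left.
have [ru|ru] := boolP (r \is a GRing.unit); first by right.
exfalso.
have lq := lehmer_mlog_factor leh a0 b0 ab E qu.
have E' : GT a b %/ CT a b = r * q by rewrite E mulrC.
have lr := lehmer_mlog_factor leh a0 b0 ab E' ru.
have [q0 r0] : q != 0 /\ r != 0 by apply/andP; rewrite -negb_or -mulf_eq0 -E.
have C0 : CT a b != 0 by rewrite monic_neq0 // CT_monic.
have := mlog_ge0 R C0.
move: upper; rewrite -divCTK E !mlog_toCM ?mulf_neq0 //.
by lra.
Qed.

End Irreducibility.

Local Close Scope classical_set_scope.

Theorem theorem1p3 (R : realType) :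
  (* (a) the cyclotomic part of G^T_{a,b} is C^T_{a,b} *)
  (forall a b : nat, (0 < a)%N -> (0 < b)%N ->
     [/\ CT a b %| GT a b,
         (forall k, (0 < k)%N -> 'Phi_k %| CT a b -> ~~ ('Phi_k ^+ 2 %| GT a b)) &
         (forall k, (0 < k)%N -> ~~ ('Phi_k %| GT a b %/ CT a b))]) /\
  (* (b) for a <> b, G^T_{a,b} is a product of irreducible reciprocal polys *)
  (forall a b : nat, (0 < a)%N -> (0 < b)%N -> a <> b ->
     exists s : seq {poly int},
       (forall q, q \in s -> irreducibleZ q /\ reciprocal q) /\
       GT a b = \prod_(q <- s) q) /\
  (* (c) under Lehmer's Conjecture *)
  (LehmerConjecture R ->
     exists C : R, forall a b : nat, (0 < a)%N -> (0 < b)%N ->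
       C < Num.max (a%:R / b%:R) (b%:R / a%:R) ->
       irreducibleZ (GT a b %/ CT a b)).
Proof.
split; first by move=> a b; exact: part_a.
by split; [move=> a b; exact: part_b | exact: part_c].
Qed.
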